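(* Let $n\ge 3$. The dual graph $D(\mathcal{T}_n^{\mathrm{LRL}})$ is a subgraph of the $(n-2)$-dimensional square grid graph via the embedding $\Delta\mapsto\mathbf{x}(\Delta)$. That is, the map $\Delta\mapsto \mathbf{x}(\Delta)$ from $\mathcal{T}_n^{\mathrm{LRL}}$ to $\mathbb{Z}^{n-2}$ is injective, and whenever two simplices $\Delta,\Delta'\in\mathcal{T}_n^{\mathrm{LRL}}$ are adjacent, $\mathbf{x}(\Delta)$ and $\mathbf{x}(\Delta')$ are adjacent in the square grid graph.
   Context: The contracted zigzag graph $G_n$ (written $\widehat{\mathrm{Zig}}_n$) is the directed multigraph with vertices $1,\dots,n$ and edges $x_i=(i,i+1)$ for $1\le i\le n-1$ (slack edges), $y_0=(1,2)$, $y_i=(i,i+2)$ for $1\le i\le n-2$, and $y_{n-1}=(n-1,n)$ (nonslack edges). The inner vertices are $2,\dots,n-1$. Each inner vertex $i$ has incoming edges $\{x_{i-1},y_{i-2}\}$ and outgoing edges $\{x_i,y_i\}$. The length-reverse-length (LRL) framing orders them by $y_{i-2}\prec x_{i-1}$ (incoming) and $x_i\prec y_i$ (outgoing) at every inner vertex $i$. A route is a directed path from $1$ to $n$; a prefix at $i$ is a directed path from $1$ to $i$; a suffix at $i$ is a directed path from $i$ to $n$. Paths are sequences of edges (parallel edges are distinguished). For distinct prefixes $P,P'$ at an inner vertex $i$, let $j\le i$ be the vertex after which they coincide and which they enter along different edges $e$ (of $P$) and $e'$ (of $P'$); set $P\prec P'$ if $e\prec e'$ in the incoming order at $j$. For distinct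 suffixes $Q,Q'$ at $i$, let $k\ge i$ be the first vertex which they leave along different edges $e$ (of $Q$), $e'$ (of $Q'$); set $Q\prec Q'$ if $e\prec e'$ in the outgoing order at $k$. Two routes $R=PiQ$ and $R'=P'iQ'$ through a common inner vertex $i$ (with prefixes $P,P'$ and suffixes $Q,Q'$ at $i$) conflict at $i$ if the prefixes and suffixes are oppositely ordered ($P\prec P'$ and $Q'\prec Q$, or vice versa). A maximal clique is an inclusion-maximal set of routes no two of which conflict at any vertex. Each route is identified with its 0/1 indicator vector in $\mathbb{R}^{E(G_n)}$, a vertex of the flow polytope of nonnegative unit flows from $1$ to $n$. For a maximal clique $C$, $\Delta_C$ is the convex hull of its routes; the $\Delta_C$ are the maximal simplices of a regular unimodular triangulation of this flow polytope (Danilov–Karzanov–Koshevoy). $\mathcal{T}_n^{\mathrm{LRL}}$ denotes the set of these simplices. Two simplices are adjacent if they share a codimension 1 face, equivalently if their maximal cliques differ by exactly one route. The dual graph $D(\mathcal{T}_n^{\mathrm{LRL}})$ has vertex set $\mathcal{T}_n^{\mathrm{LRL}}$ and an edge between each pair of adjacent simplices. $\mathcal{F}_n^{\mathbb{Z}}$ is the set of functions $\phi:E(G_n)\to\mathbb{Z}_{\ge0}$ with $\sum_{e\text{ into }i}\phi(e)+d_i=\sum_{e\text{ out of }i}\phi(e)$ for every vertex $i$, where $(d_1,\dots,d_n)=(0,1,1,\dots,1,-(n-2))$. There is a bijection (Mészáros–Morales–Striker) $\Delta_C\mapsto\phi(\Delta_C)$ from $\mathcal{T}_n^{\mathrm{LRL}}$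 to $\mathcal{F}_n^{\mathbb{Z}}$: $\phi(\Delta_C)(e)=0$ if $e$ leaves vertex $1$, and if $e$ leaves an inner vertex $i$, then $\phi(\Delta_C)(e)$ is one less than the number of prefixes $P$ at $i$ such that some route of $C$ begins with $P$ followed by $e$. Elementary moves on $\mathcal{F}_n^{\mathbb{Z}}$, for $2\le i\le n-1$: if $\phi(x_i)>0$ and $\phi(y_{i+1})>0$, then $m_i^+(\phi)$ is the flow obtained by subtracting one from $\phi(x_i)$ and $\phi(y_{i+1})$ and adding one to $\phi(x_{i+2})$ and $\phi(y_i)$; otherwise $m_i^+$ does not apply. If $\phi(x_{i+2})>0$ and $\phi(y_i)>0$, then $m_i^-(\phi)$ is the flow obtained by subtracting one from $\phi(x_{i+2})$ and $\phi(y_i)$ and adding one to $\phi(x_i)$ and $\phi(y_{i+1})$; otherwise $m_i^-$ does not apply. When $i\in\{n-2,n-1\}$, all conditions and operations involving the nonexistent values $\phi(x_n),\phi(y_n),\phi(x_{n+1})$ are ignored. Coordinate vector: let $\phi_0\in\mathcal{F}_n^{\mathbb{Z}}$ be the flow with $\phi_0(x_i)=i-1$ for $1\le i\le n-1$ and value $0$ on all nonslack edges. For each $\Delta\in\mathcal{T}_n^{\mathrm{LRL}}$ there is a (possibly empty) sequence of elementary moves $(m_{j_1}^{\epsilon_1},\dots,m_{j_l}^{\epsilon_l})$, $\epsilon_k\in\{+,-\}$, with $\phi(\Delta)=m_{j_l}^{\epsilon_l}\circ\cdots\circ m_{j_1}^{\epsilon_1}(\phi_0)$ (each move applicable). Define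 $\mathbf{x}(\Delta)=\sum_{k=1}^l\epsilon_k\mathbf{e}_{j_k}\in\mathbb{Z}^{n-2}$, where $\mathbf{e}_2,\dots,\mathbf{e}_{n-1}$ are the standard basis vectors of $\mathbb{Z}^{n-2}$ (coordinates indexed by $2,\dots,n-1$) and $\epsilon_k$ is read as $\pm1$; this vector does not depend on the choice of sequence. The $(n-2)$-dimensional square grid graph has vertex set $\mathbb{Z}^{n-2}$, two points being adjacent if and only if they differ by $\pm\mathbf{e}_k$ for some $k$. *)

(* Defs.v *)
From mathcomp Require Import all_boot all_order all_algebra.
From mathcomp Require Import classical_sets reals.

Set Implicit Arguments.
Unset Strict Implicit.
Unset Printing Implicit Defensive.

Import Order.TTheory GRing.Theory Num.Theory.
Local Open Scope ring_scope.

(* The vertices 1, ..., n are plain natural numbers.  An edge inl k is the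
   slack edge x_(k+1), 0 <= k < n-1, and an edge inr k is the nonslack edge
   y_k, 0 <= k < n. *)
Definition edge (n : nat) : Type := ('I_n.-1 + 'I_n)%type.

Definition is_x n (i : nat) (e : edge n) : bool :=
  if e is inl k then k.+1 == i else false.

Definition is_y n (i : nat) (e : edge n) : bool :=
  if e is inr k then val k == i else false.

Definition src n (e : edge n) : nat :=
  match e with
  | inl k => k.+1
  | inr k => if val k == 0 then 1 else k
  end%N.

Definition tgt n (e : edge n) : nat :=
  match e with
  | inl k => k.+2
  | inr k => if val k == 0 then 2 else if val k == n.-1 then n else k.+2
  end%N.

Definition inner (n i : nat) : bool := (1 < i < n)%N.

(* The length-reverse-length framing at the inner vertex i. *)
Definition in_prec n (i : nat) (e e' : edge n) : Prop :=
  [/\ inner n i, is_y (i - 2) e & is_x (i - 1) e'].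

Definition out_prec n (i : nat) (e e' : edge n) : Prop :=
  [/\ inner n i, is_x i e & is_y i e'].

(* p is a directed path from u to v. *)
Fixpoint dpath n (u : nat) (p : seq (edge n)) (v : nat) : bool :=
  if p is e :: p' then (src e == u) && dpath (tgt e) p' v else u == v.

(* As edges increase vertices, a directed path from 1 has at most n-1 edges;
   bounding the length of routes and prefixes by n excludes nothing and gives
   finite types. *)
Definition route (n : nat) : Type := {r : n.-bseq (edge n) | dpath 1 r n}.

Definition edges n (r : route n) : seq (edge n) := val (val r).

Definition prefix_prec n (P P' : seq (edge n)) : Prop :=
  exists P1 P1' S e e',
    [/\ P = P1 ++ e :: S, P' = P1' ++ e' :: S & in_prec (tgt e) e e'].

Definition suffix_prec n (Q Q' : seq (edge n)) : Prop :=
  exists S Q1 Q1' e e',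
    [/\ Q = S ++ e :: Q1, Q' = S ++ e' :: Q1' & out_prec (src e) e e'].

Definition conflict_at n (i : nat) (r r' : route n) : Prop :=
  inner n i /\
  exists P Q P' Q' : seq (edge n),
    [/\ edges r = P ++ Q, edges r' = P' ++ Q',
        dpath 1 P i && dpath i Q n, dpath 1 P' i && dpath i Q' n &
        (prefix_prec P P' /\ suffix_prec Q' Q) \/
        (prefix_prec P' P /\ suffix_prec Q Q')].

Definition clique n (C : {set route n}) : Prop :=
  forall r r', r \in C -> r' \in C -> forall i, ~ conflict_at i r r'.

Definition maximal_clique n (C : {set route n}) : Prop :=
  clique C /\ forall C' : {set route n}, C \subset C' -> clique C' -> C' = C.

Definition indicator (R : realType) n (r : route n) : {ffun edge n -> R} :=
  [ffun e => (e \in edges r)%:R].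

(* The convex hull of (the indicator vectors of) a set of routes. *)
Definition hull (R : realType) n (C : {set route n}) :
    set {ffun edge n -> R} :=
  [set v | exists w : route n -> R,
     [/\ forall r, r \in C -> 0 <= w r, \sum_(r in C) w r = 1 &
         v = [ffun e => \sum_(r in C) w r * indicator R r e]]]%classic.
Arguments hull R [n] C _.

Definition triangulation (R : realType) (n : nat) :
    set (set {ffun edge n -> R}) :=
  [set D | exists C : {set route n}, maximal_clique C /\ D = hull R C]%classic.
Arguments triangulation R n _ : clear implicits.

(* F is a codimension 1 face of the simplex D: the hull of all the vertices of
   D but one. *)
Definition facet (R : realType) n (F D : set {ffun edge n -> R}) : Prop :=
  exists (C : {set route n}) (r : route n),
    [/\ maximal_clique C, D = hull R C, r \in C & F = hull R (C :\ r)].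

(* The edge relation of the dual graph, whose vertex set is the
   triangulation. *)
Definition dual_adjacent (R : realType) n (D D' : set {ffun edge n -> R}) :
    Prop :=
  D <> D' /\ exists F, facet F D /\ facet F D'.

Definition netflow (n i : nat) : int :=
  if i == 1%N then 0 else if i == n then - (n%:Z - 2) else 1.

Definition integer_flow n (f : {ffun edge n -> int}) : Prop :=
  (forall e, 0 <= f e) /\
  forall i : nat, (1 <= i <= n)%N ->
    \sum_(e | tgt e == i) f e + netflow n i = \sum_(e | src e == i) f e.

Definition flow_of_clique n (C : {set route n}) : {ffun edge n -> int} :=
  [ffun e => if src e == 1%N then 0 else
     #|[set P : n.-bseq (edge n) | dpath 1 P (src e) &
         [exists r in C, prefix (rcons P e) (edges r)]]|%:Z - 1].

(* A move (b, k) is m_(k+2)^+ if b is true and m_(k+2)^- if b is false; k is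
   also the index of the basis vector e_(k+2) of Z^(n-2). *)
Definition move (n : nat) : Type := (bool * 'I_(n - 2))%type.

(* Quantifying over the existing edges ignores the nonexistent x_n, y_n,
   x_(n+1). *)
Definition dec_edge n (m : move n) (e : edge n) : bool :=
  let i := m.2.+2 in
  if m.1 then is_x i e || is_y i.+1 e else is_x i.+2 e || is_y i e.

Definition inc_edge n (m : move n) (e : edge n) : bool :=
  let i := m.2.+2 in
  if m.1 then is_x i.+2 e || is_y i e else is_x i e || is_y i.+1 e.

Definition applies n (m : move n) (f : {ffun edge n -> int}) : Prop :=
  integer_flow f /\ forall e, dec_edge m e -> 0 < f e.

Definition apply_move n (m : move n) (f : {ffun edge n -> int}) :
    {ffun edge n -> int} :=
  [ffun e => f e - (dec_edge m e)%:Z + (inc_edge m e)%:Z].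

(* The moves ms, performed from left to right, lead from f to g. *)
Fixpoint moves_lead n (f : {ffun edge n -> int}) (ms : seq (move n))
    (g : {ffun edge n -> int}) : Prop :=
  if ms is m :: ms' then applies m f /\ moves_lead (apply_move m f) ms' g
  else f = g.

(* The value i - 1 on x_i = inl k is k, as i = k + 1. *)
Definition flow0 (n : nat) : {ffun edge n -> int} :=
  [ffun e : edge n => (if e is inl k then k%:Z else 0) : int].

Definition displacement n (ms : seq (move n)) : 'rV[int]_(n - 2) :=
  \sum_(m <- ms) (if m.1 then 1 else -1) *: delta_mx 0 m.2.

(* v is the coordinate vector of the simplex D computed from some sequence of
   elementary moves. *)
Definition coordinate_vector (R : realType) n (D : set {ffun edge n -> R})
    (v : 'rV[int]_(n - 2)) : Prop :=
  exists (C : {set route n}) (ms : seq (move n)),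
    [/\ maximal_clique C, D = hull R C,
        moves_lead (flow0 n) ms (flow_of_clique C) & v = displacement ms].

Definition grid_adjacent (d : nat) (u v : 'rV[int]_d) : Prop :=
  exists k : 'I_d, v = u + delta_mx 0 k \/ v = u - delta_mx 0 k.

(* Main.v *)
(* Two routes conflicting at a vertex can be spliced there, and a route
   conflicting with the splice conflicts with one of the two or at the splicing
   vertex.  Hence every edge is covered by a maximal clique C, and consecutive
   prefixes at an inner vertex share a suffix, so exactly one prefix continues
   along both outgoing edges; counting prefixes gives flow conservation.  Given
   the prefixes at i, those continuing along x_i form an initial segment, whose
   size is read off the flow, so the flow determines C.

   Let two maximal cliques differ by replacing r with r', and let v be the last
   vertex where r = PQ and r' = P'Q' conflict.  Both PQ' and P'Q then lie in the
   common part, Q = y_v x_(v+2) T and Q' = x_v y_(v+1) T (truncated at n), so the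
   flows differ by the single move m_v.  As y_j gains from m_j and loses from
   m_(j-1), the k-th coordinate of a flow is the sum of phi(y_j), 2 <= j <= k;
   with conservation it determines the flow.  Lowering the last nonzero y_j
   connects every flow to phi_0. *)
Require Import Defs.
From mathcomp Require Import all_boot all_order all_algebra.
From mathcomp Require Import classical_sets reals.
From mathcomp Require Import finset zify.

Set Implicit Arguments.
Unset Strict Implicit.
Unset Printing Implicit Defensive.

(** Maximality enters only in one form: a route compatible with every route of C lies in C.
    Existence claims are therefore proved by exhibiting a spliced route and checking it at the few
    vertices where splicing could create a conflict. The last conflict v is chosen because PQ'
    follows r' after v: a conflict of PQ' with r beyond v would be one of r' with r. At v itself PQ'
    and r share the prefix P. That x does not depend on the sequence of moves comes from the
    coordinates being a linear function of the flow, on which each move acts by plus or minus a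
    basis vector. The statement speaks of hulls. A hull determines its clique because the edge set
    of a route never contains that of another route; adjacency of simplices thus becomes an exchange
    of one route. *)

(** * Lexicographic orders *)

Section Lex.
Variables (T : eqType) (lt : rel T).

(** Two lists of which one is a prefix of the other are incomparable. Nothing is lost by this, since
    distinct paths with the same two ends are never prefixes of each other. *)
Fixpoint lex (s t : seq T) : bool :=
  if s is a :: s' then
    if t is b :: t' then if a == b then lex s' t' else lt a b else false
  else false.

Lemma lex_irr s : lex s s = false.
Proof. by elim: s => //= a s ->; rewrite eqxx. Qed.

Lemma lex_cat s t u : lex (s ++ t) (s ++ u) = lex t u.
Proof. by elim: s => //= a s ->; rewrite eqxx. Qed.

(** The comparison with [s] is settled inside [a], whatever follows; this is what makes tails
    exchangeable in a splice. *)
Lemma lex_catl_notprefix a s b c :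
  ~~ prefix a s -> lex (a ++ b) s = lex (a ++ c) s.
Proof.
by elim: a s => [|x a IH] [|y s] //=; rewrite eq_sym; case: eqP => //= _ /IH.
Qed.

Lemma lex_catr_notprefix a s b c :
  ~~ prefix a s -> lex s (a ++ b) = lex s (a ++ c).
Proof.
by elim: a s => [|x a IH] [|y s] //=; rewrite eq_sym; case: eqP => //= _ /IH.
Qed.

Lemma lex_trans : irreflexive lt -> transitive lt -> transitive lex.
Proof.
move=> irr tr t s u; elim: t s u => [|b t IH] [|a s] [|c u] //=.
case: (eqVneq a b) => [->|ab]; case: (eqVneq b c) => [bc'|bc] //.
- exact: IH.
- by rewrite -bc' (negPf ab).
- case: eqP => [->|_]; last exact: tr.
  by move=> cb bc'; move: (tr _ _ _ cb bc'); rewrite irr.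
Qed.

Lemma lexP s t : irreflexive lt ->
  lex s t <-> exists S a b s' t',
    [/\ s = S ++ a :: s', t = S ++ b :: t' & lt a b].
Proof.
move=> irr; split=> [|[S [a [b [s' [t' [-> -> ab]]]]]]]; last first.
  by rewrite lex_cat /=; case: eqP => // abE; move: ab; rewrite abE irr.
elim: s t => [|a s IH] [|b t] //=; case: eqP => [<- /IH|_ ab].
  by move=> [S [x [y [s' [t' [-> -> xy]]]]]]; exists (a :: S), x, y, s', t'.
by exists [::], a, b, s, t.
Qed.

End Lex.

(** Lists of edges do not form a finite type, so an extreme prefix or suffix is found by maximizing
    [f] over a finite set of routes. *)
Lemma ex_max (X : finType) (T : Type) (lt : rel T) (f : X -> T) (A : {set X}) :
  irreflexive lt -> transitive lt -> A != set0 ->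
  exists2 x, x \in A & forall y, y \in A -> ~~ lt (f x) (f y).
Proof.
move=> irr tr; have [m] := ubnP #|A|; elim: m A => // m IH A Am.
case/set0Pn=> x xA.
have [B0|] := eqVneq [set y in A | lt (f x) (f y)] set0.
  exists x => // y yA; apply/negP => xy.
  by have := in_set0 y; rewrite -B0 inE yA xy.
move=> B0; have [|y] := IH [set y in A | lt (f x) (f y)] _ B0.
  rewrite -ltnS; apply: leq_trans Am; rewrite ltnS; apply: proper_card; apply/properP; split.
    by apply/fintype.subsetP => y; rewrite inE => /andP[].
  by exists x; rewrite // inE irr andbF.
rewrite inE => /andP[yA xy] ymax; exists y => // z zA; apply/negP => yz.
by have := ymax z; rewrite inE zA (tr _ _ _ xy yz) yz => /(_ isT).
Qed.

(** * Edges, paths and conflicts *)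

Section Zigzag.
Variable n : nat.
Hypothesis hn : 2 < n.
Local Notation edge := (edge n).
Local Notation route := (route n).
Implicit Types (e : edge) (r : route) (P Q : seq edge).

Definition isx e : bool := if e is inl _ then true else false.

Lemma src_gt0 e : 0 < src e.
Proof. by case: e => //= k; case: eqP => //; lia. Qed.

(** The minimum with n covers y_(n-1), which ends at n instead of n+1. *)
Lemma tgtE e :
  tgt e = if isx e then (src e).+1
          else if is_y 0 e then 2 else minn n (src e).+2.
Proof.
case: e => //= k; have := ltn_ord k; case: eqP => // k0.
by case: eqP => [-> | ?]; lia.
Qed.

Lemma src_lt_tgt e : src e < tgt e.
Proof.
rewrite tgtE; case: e => //= k; have := ltn_ord k.
by case: eqP; lia.
Qed.

Lemma tgt_le e : tgt e <= n.
Proof.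
rewrite tgtE; case: e => //= k; have := ltn_ord k; first lia.
by case: eqP; lia.
Qed.

Lemma tgt_gt1 e : 1 < tgt e.
Proof. by have := src_gt0 e; have := src_lt_tgt e; lia. Qed.

(** At an inner vertex the kind alone tells the two outgoing edges apart. This fails at vertex 1,
    which both y_0 and y_1 leave. *)
Lemma edge_src_inj e e' :
  inner n (src e) -> src e' = src e -> isx e' = isx e -> e' = e.
Proof.
rewrite /inner; case: e e' => k [] l //= ke le _.
  by congr inl; apply: val_inj; case: le.
by congr inr; apply: val_inj => /=; move: ke le; do 2?case: eqP; lia.
Qed.

Lemma edge_tgt_inj e e' :
  inner n (tgt e) -> tgt e' = tgt e -> isx e' = isx e -> e' = e.
Proof.
rewrite /inner; case: e e' => k [] l //= ke le _.
  by congr inl; apply: val_inj; case: le.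
have kn := ltn_ord k; have ln := ltn_ord l.
by congr inr; apply: val_inj => /=; move: ke le; do 4?case: eqP; lia.
Qed.

Lemma edge_src_ex i b : inner n i -> exists2 e, src e = i & isx e = b.
Proof.
rewrite /inner => /andP[i1 ilt]; case: b.
  have ilt' : i.-1 < n.-1 by lia.
  by exists (inl (Ordinal ilt')) => //=; lia.
by exists (inr (Ordinal ilt)) => //=; case: eqP; lia.
Qed.

Lemma edge_tgt_ex i b : inner n i -> exists2 e, tgt e = i & isx e = b.
Proof.
rewrite /inner => /andP[i1 ilt]; case: b.
  have ilt' : i.-2 < n.-1 by lia.
  by exists (inl (Ordinal ilt')) => //=; lia.
have ilt' : i.-2 < n by lia.
by exists (inr (Ordinal ilt')) => //=; do 2?case: eqP; lia.
Qed.

Definition in_lt e e' := [&& inner n (tgt e), tgt e' == tgt e, ~~ isx e & isx e'].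
Definition out_lt e e' := [&& inner n (src e), src e' == src e, isx e & ~~ isx e'].

Lemma in_precP e e' : in_prec (tgt e) e e' <-> in_lt e e'.
Proof.
rewrite /in_prec /in_lt /inner.
case: e e' => k [] l //=; try by split=> [[]|]; rewrite ?andbF.
have kn := ltn_ord k; have ln := ltn_ord l; rewrite !andbT.
split=> [[h1 h2 h3]|/andP[h1 h2]]; 
  [move: h1 h2 h3|split; move: h1 h2]; do 2?case: eqP; lia.
Qed.

Lemma out_precP e e' : out_prec (src e) e e' <-> out_lt e e'.
Proof.
rewrite /out_prec /out_lt /inner.
case: e e' => k [] l //=; try by split=> [[]|]; rewrite ?andbF.
have kn := ltn_ord k; have ln := ltn_ord l; rewrite ?andbT.
split=> [[h1 h2 h3]|/andP[h1 h2]]; 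
  [move: h1 h2 h3|split; move: h1 h2]; case: ifP; lia.
Qed.

Lemma in_lt_irr : irreflexive in_lt.
Proof. by move=> e; rewrite /in_lt; case: isx; rewrite ?andbF. Qed.

Lemma out_lt_irr : irreflexive out_lt.
Proof. by move=> e; rewrite /out_lt; case: isx; rewrite ?andbF. Qed.

Lemma in_lt_trans : transitive in_lt.
Proof. by move=> e f g /and4P[_ _ _ h] /and4P[_ _]; rewrite h. Qed.

Lemma out_lt_trans : transitive out_lt.
Proof. by move=> e f g /and4P[_ _ _ h] /and4P[_ _ h']; rewrite h' in h. Qed.

(** * The orders on prefixes and suffixes *)

Definition plt P P' := lex in_lt (rev P) (rev P').
Definition slt Q Q' := lex out_lt Q Q'.

Lemma plt_irr : irreflexive plt. Proof. by move=> P; apply: lex_irr. Qed.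
Lemma slt_irr : irreflexive slt. Proof. by move=> P; apply: lex_irr. Qed.

Lemma plt_trans : transitive plt.
Proof. by move=> P P' P''; apply: lex_trans; [apply: in_lt_irr|apply: in_lt_trans]. Qed.

Lemma slt_trans : transitive slt.
Proof. exact: lex_trans out_lt_irr out_lt_trans. Qed.

Lemma plt_asym P P' : plt P P' -> ~~ plt P' P.
Proof. by move=> h; apply/negP => /(plt_trans h); rewrite plt_irr. Qed.

Lemma slt_asym P P' : slt P P' -> ~~ slt P' P.
Proof. by move=> h; apply/negP => /(slt_trans h); rewrite slt_irr. Qed.

Lemma plt_cat P P' W : plt (P ++ W) (P' ++ W) = plt P P'.
Proof. by rewrite /plt !rev_cat lex_cat. Qed.

Lemma slt_cat Q Q' W : slt (W ++ Q) (W ++ Q') = slt Q Q'.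
Proof. exact: lex_cat. Qed.

Lemma prefix_precP P P' : prefix_prec P P' <-> plt P P'.
Proof.
rewrite /plt lexP; last exact: in_lt_irr.
split=> [[P1 [P1' [W [e [e' [-> -> /in_precP h]]]]]]|].
  by exists (rev W), e, e', (rev P1), (rev P1'); split=> //;
     rewrite rev_cat rev_cons cat_rcons.
move=> [W [e [e' [P1 [P1' [h h' /in_precP ee']]]]]].
exists (rev P1), (rev P1'), (rev W), e, e'; split=> //.
  by rewrite -[LHS]revK h rev_cat rev_cons cat_rcons.
by rewrite -[LHS]revK h' rev_cat rev_cons cat_rcons.
Qed.

Lemma suffix_precP Q Q' : suffix_prec Q Q' <-> slt Q Q'.
Proof.
rewrite /slt lexP; last exact: out_lt_irr.
by split=> [[W [Q1 [Q1' [e [e' [h1 h2 /out_precP h]]]]]]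
           |[W [e [e' [Q1 [Q1' [h1 h2 /out_precP h]]]]]]];
  [exists W, e, e', Q1, Q1' | exists W, Q1, Q1', e, e'].
Qed.

(** * Directed paths and totality of the two orders *)

Lemma dpath_cat u P w Q v : dpath u P w -> dpath u (P ++ Q) v = dpath w Q v.
Proof. by elim: P u => [|e P IH] u /= => [/eqP->|/andP[-> /IH]]. Qed.

Lemma dpath_catP u P Q v :
  dpath u (P ++ Q) v -> exists2 w, dpath u P w & dpath w Q v.
Proof.
elim: P u => [|e P IH] u /=; first by exists u.
by case/andP=> -> /IH.
Qed.

Lemma dpath_rcons u P e v :
  dpath u (rcons P e) v = dpath u P (src e) && (tgt e == v).
Proof.
elim: P u => [|f P IH] u /=; first by rewrite eq_sym.
by rewrite IH andbA.
Qed.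

Lemma dpath_size u P v : dpath u P v -> u + size P <= v.
Proof.
elim: P u => [|e P IH] u /= => [/eqP->|/andP[/eqP eu /IH]]; first lia.
by have := src_lt_tgt e; lia.
Qed.

Lemma dpath_leq u P v : dpath u P v -> u <= v.
Proof. by move/dpath_size; lia. Qed.

Lemma dpath_nil u P : dpath u P u -> P = [::].
Proof. by move/dpath_size; case: P => //= e P; lia. Qed.

Lemma dpath_mem u P v e : dpath u P v -> e \in P -> u <= src e /\ tgt e <= v.
Proof.
elim: P u => //= f P IH u /andP[/eqP fu Pv]; rewrite inE => /orP[/eqP->|/(IH _ Pv)[]].
  by rewrite fu leqnn; split=> //; apply: dpath_leq Pv.
by have := src_lt_tgt f; lia.
Qed.

(** Vertices increase along a path, so it meets [i] at most once. *)
Lemma dpath_cut u P Q P' Q' i :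
  P ++ Q = P' ++ Q' -> dpath u P i -> dpath u P' i -> P = P'.
Proof.
elim: P P' u => [|e P IH] [|e' P'] u //=.
- move=> _ /eqP-> h; have/dpath_nil : dpath i (e' :: P') i by [].
  by [].
- move=> _ h /eqP ui; have/dpath_nil : dpath i (e :: P) i by rewrite -{1}ui.
  by [].
by case=> -> h /andP[_ h1] /andP[_ h2]; rewrite (IH _ _ h h1 h2).
Qed.

(** Strip common last edges. The stripping cannot reach vertex 1, where both prefixes would be
    empty; it stops at an inner vertex entered along two edges of different kinds, which the framing
    compares. *)
Lemma plt_total i P P' : inner n i -> dpath 1 P i -> dpath 1 P' i ->
  P != P' -> plt P P' || plt P' P.
Proof.
elim/last_ind: P P' i => [|P e IH] P' i ii.
  by move=> /eqP <- /dpath_nil ->.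
elim/last_ind: P' => [|P' e' _] h.
  by move=> /eqP i1; rewrite -i1 in ii.
move: h; rewrite !dpath_rcons => /andP[h1 /eqP h2] /andP[h1' /eqP h2'].
rewrite /plt !rev_rcons /= (eq_sym e').
have [ee'|ne] := eqVneq e e'.
  subst e'; rewrite eqseq_rcons eqxx andbT => ne; apply: (IH _ (src e)) => //.
  rewrite /inner; have := src_lt_tgt e; have := src_gt0 e; have := tgt_le e.
  have [e1 *|] := eqVneq (src e) 1; last by lia.
  move: h1 h1' ne; rewrite e1 => /dpath_nil-> /dpath_nil->.
  by rewrite eqxx.
move=> _; rewrite /in_lt h2 h2' ii eqxx /=.
have : isx e' != isx e.
  apply: contra_neqN ne => /eqP h; symmetry; apply: edge_tgt_inj => //.
    by rewrite h2.
  by rewrite h2 h2'.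
by case: isx; case: isx.
Qed.

Lemma slt_total i Q Q' : inner n i -> dpath i Q n -> dpath i Q' n ->
  Q != Q' -> slt Q Q' || slt Q' Q.
Proof.
elim: Q Q' i => [|e Q IH] Q' i ii /=.
  by move=> /eqP ->  /dpath_nil ->.
case: Q' => [|e' Q'] /= h.
  by move=> /eqP i1; move: ii; rewrite i1 /inner ltnn andbF.
move: h => /andP[/eqP h2 h1] /andP[/eqP h2' h1'].
rewrite /slt /= (eq_sym e').
have [ee'|ne] := eqVneq e e'.
  subst e'; rewrite eqseq_cons eqxx /= => ne; apply: (IH _ (tgt e)) => //.
  rewrite /inner tgt_gt1 ltn_neqAle tgt_le andbT /=.
  apply: contra_neqN ne => /eqP en; move: h1 h1'; rewrite en.
  by move=> /dpath_nil-> /dpath_nil->.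
move=> _; rewrite /out_lt h2 h2' ii eqxx /=.
have : isx e' != isx e.
  apply: contra_neqN ne => /eqP h; symmetry; apply: edge_src_inj => //.
    by rewrite h2.
  by rewrite h2 h2'.
by case: isx; case: isx.
Qed.

(** * Routes through a vertex and their compatibility *)

Lemma edges_path r : dpath 1 (edges r) n.
Proof. exact: (valP r). Qed.

Lemma edges_inj : injective (@edges n).
Proof. by move=> r r' h; apply: val_inj; apply: val_inj. Qed.

Lemma route_ex s : dpath 1 s n -> exists r, edges r = s.
Proof.
move=> h; have sz : size s <= n by move/dpath_size: h; lia.
by exists (exist _ (Bseq sz) h : route).
Qed.

Definition thru i r P Q := [/\ edges r = P ++ Q, dpath 1 P i & dpath i Q n].

Lemma thru_ex i P Q : dpath 1 P i -> dpath i Q n -> exists r, thru i r P Q.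
Proof.
move=> h1 h2; have [|r h] := @route_ex (P ++ Q); last by exists r.
by rewrite (dpath_cat _ _ h1).
Qed.

Lemma thru_cat i r P Q : edges r = P ++ Q -> dpath 1 P i -> thru i r P Q.
Proof. by move=> h h1; split=> //; have := edges_path r; rewrite h (dpath_cat _ _ h1). Qed.

Lemma thru_uniq i r P Q P' Q' : thru i r P Q -> thru i r P' Q' -> P = P' /\ Q = Q'.
Proof.
move=> [h h1 _] [h' h1' _]; have h2 : P ++ Q = P' ++ Q' by rewrite -h.
have e := dpath_cut h2 h1 h1'; split=> //; subst P'.
by move/eqP: h2; rewrite eqseq_cat // eqxx => /eqP.
Qed.

Lemma thru_catl i j r P W Q : thru j r (P ++ W) Q -> dpath 1 P i -> thru i r P (W ++ Q).
Proof. by move=> [h h1 h2] hP; apply: thru_cat => //; rewrite catA. Qed.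

Lemma thru_catr i j r P W Q : thru j r P (W ++ Q) -> dpath j W i -> thru i r (P ++ W) Q.
Proof.
by move=> [h h1 h2] hP; apply: thru_cat; rewrite -?catA // (dpath_cat _ _ h1).
Qed.

Definition conf P Q P' Q' := (plt P P' && slt Q' Q) || (plt P' P && slt Q Q').

Lemma confC P Q P' Q' : conf P Q P' Q' = conf P' Q' P Q.
Proof. by rewrite /conf orbC. Qed.

Definition compat r r' := forall i P Q P' Q', inner n i ->
  thru i r P Q -> thru i r' P' Q' -> ~~ conf P Q P' Q'.

Lemma compatP r r' : (forall i, ~ conflict_at i r r') <-> compat r r'.
Proof.
split=> [h i P Q P' Q' ii [h1 h2 h3] [h1' h2' h3']|h i].
  apply/negP => hc; apply: (h i); split=> //; exists P, Q, P', Q'.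
  rewrite h2 h3 h2' h3'; split=> //; case/orP: hc => /andP[c1 c2]; [left|right];
  by split; [apply/prefix_precP|apply/suffix_precP].
case=> ii [P [Q [P' [Q' [h1 h1' /andP[h2 h3] /andP[h2' h3'] hc]]]]].
have /negP[] := h i P Q P' Q' ii (And3 h1 h2 h3) (And3 h1' h2' h3').
by apply/orP; case: hc => [[/prefix_precP c1 /suffix_precP c2]|[/prefix_precP c1 /suffix_precP c2]];
  [left|right]; apply/andP.
Qed.

Lemma compat_sym r r' : compat r r' -> compat r' r.
Proof. by move=> h i P Q P' Q' ii t t'; rewrite confC; apply: h t' t. Qed.

Lemma compat_refl r : compat r r.
Proof.
move=> i P Q P' Q' ii t t'; have [<- _] := thru_uniq t t'.
by rewrite /conf plt_irr.
Qed.

Definition compat_at i r r' := forall P Q P' Q',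
  thru i r P Q -> thru i r' P' Q' -> ~~ conf P Q P' Q'.

Lemma compatW r r' i : compat r r' -> inner n i -> compat_at i r r'.
Proof. by move=> h ii P Q P' Q'; apply: h. Qed.

Lemma compat_atC i r r' : compat_at i r r' -> compat_at i r' r.
Proof. by move=> h P Q P' Q' t t'; rewrite confC; apply: h t' t. Qed.

(** * Splicing *)

Lemma splice_left P1 P2 Z Z1 S0 S1 : conf P1 (P2 ++ Z) S0 S1 ->
  conf P1 (P2 ++ Z1) S0 S1 \/
  exists2 S2, S1 = P2 ++ S2 & conf (P1 ++ P2) Z (S0 ++ P2) S2.
Proof.
have [/prefixP[S2 ->]|np] := boolP (prefix P2 S1).
  by rewrite /conf !slt_cat => h; right; exists S2; rewrite // !plt_cat.
rewrite /conf /slt (lex_catl_notprefix _ _ Z1 np) (lex_catr_notprefix _ _ Z1 np).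
by left.
Qed.

Lemma splice_right Q1 Q2 Z Z1 S0 S1 : conf (Z ++ Q1) Q2 S0 S1 ->
  conf (Z1 ++ Q1) Q2 S0 S1 \/
  exists2 S2, S0 = S2 ++ Q1 & conf Z (Q1 ++ Q2) S2 (Q1 ++ S1).
Proof.
have [/suffixP[S2 ->]|np] := boolP (suffix Q1 S0).
  by rewrite /conf !plt_cat => h; right; exists S2; rewrite // !slt_cat.
rewrite /conf /plt !rev_cat (lex_catl_notprefix _ _ (rev Z1) np).
by rewrite (lex_catr_notprefix _ _ (rev Z1) np); left.
Qed.

Lemma dpath_split u P Q P' Q' i j : P ++ Q = P' ++ Q' ->
  dpath u P i -> dpath u P' j -> i <= j -> exists2 W, P' = P ++ W & dpath i W j.
Proof.
elim: P P' u => [|e P IH] [|e' P'] u //=.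
- by move=> _ /eqP-> h _; exists [::].
- by move=> _ /eqP-> h _; exists (e' :: P').
- move=> _ /andP[/eqP <- /dpath_leq h] /eqP <-; have := src_lt_tgt e; lia.
by case=> -> h /andP[_ h1] /andP[_ h2] /(IH _ _ h h1 h2)[W -> hW]; exists W.
Qed.

Lemma dpath_start k w Q i : dpath k Q i -> dpath w Q i -> w = k.
Proof. by case: Q => [|e Q] /= => [/eqP-> /eqP|/andP[/eqP-> _] /andP[/eqP->]]. Qed.

(* A conflict before j either persists when the tail of R is replaced by that of
   r1, or S follows R up to j and the conflict moves to j; dually after k. *)
Lemma compat_splice R S j k P W Q :
  edges R = P ++ W ++ Q -> dpath 1 P j -> dpath j W k ->
  (j = 1 \/ inner n j /\ exists r1 Z1, thru j r1 P Z1 /\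
     forall i, inner n i -> i < j -> compat_at i r1 S) ->
  (k = n \/ inner n k /\ exists r2 Z2, thru k r2 Z2 Q /\
     forall i, inner n i -> k < i -> compat_at i r2 S) ->
  (forall i, inner n i -> j <= i <= k -> compat_at i R S) ->
  compat R S.
Proof.
move=> eR hP hW h1 h2 h3 i P0 Q0 S0 S1 ii tR tS.
have tj : thru j R P (W ++ Q) by exact: thru_cat.
have tk : thru k R (P ++ W) Q by exact: thru_catr tj hW.
have jk := dpath_leq hW.
have [ij|ji] := ltnP i j.
  case: h1 => [j1|[ij' [r1 [Z1 [t1 c1]]]]]; first by move: ii; rewrite /inner; lia.
  case: tR tj => eR' hP0 _ [eR2 _ _].
  have [|P2 eP hP2] := dpath_split _ hP0 hP (ltnW ij) (Q := Q0) (Q' := W ++ Q).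
    by rewrite -eR'.
  subst P; have tj := thru_cat eR2 hP.
  have [_ eQ0] := thru_uniq (thru_cat eR' hP0) (thru_catl tj hP0); subst Q0.
  apply/negP => /(splice_left Z1)[cf|[S2 eS1 cf]].
    by have /negP[] := c1 i ii ij _ _ _ _ (thru_catl t1 hP0) tS.
  have jjk : j <= j <= k by rewrite leqnn.
  by subst S1; have /negP[] := h3 j ij' jjk _ _ _ _ tj (thru_catr tS hP2).
have [ik|ki] := leqP i k; first by apply: (h3 i ii) tR tS; apply/andP.
case: h2 => [kn|[ik' [r2 [Z2 [t2 c2]]]]]; first by move: ii; rewrite /inner; lia.
case: tR tk => eR' hP0 _ [eR2 hPW _].
have [|Q1 eP hQ1] := dpath_split _ hPW hP0 (ltnW ki) (Q := Q) (Q' := Q0).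
  by rewrite -eR'.
subst P0; have tk := thru_cat eR2 hPW.
have eQ : Q = Q1 ++ Q0.
  by move/eqP: eR'; rewrite eR2 -!catA !eqseq_cat // !eqxx /= => /eqP.
subst Q.
apply/negP => /(splice_right Z2)[cf|[S2 eS0 cf]].
  by have /negP[] := c2 i ii ki _ _ _ _ (thru_catr t2 hQ1) tS.
subst S0; have hS2 : dpath 1 S2 k.
  by case: tS => _ /dpath_catP[w w1 w2] _; rewrite -(dpath_start hQ1 w2).
have jkk : j <= k <= k by rewrite leqnn jk.
by have /negP[] := h3 k ik' jkk _ _ _ _ tk (thru_catl tS hS2).
Qed.

(** * Maximal cliques *)

Implicit Types C : {set route}.

Definition maxcl C := {in C &, forall r r', compat r r'} /\
  (forall r, {in C, forall r', compat r r'} -> r \in C).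

Lemma maximal_clique_maxcl C : maximal_clique C -> maxcl C.
Proof.
case=> cl mx; have cl' : {in C &, forall r r', compat r r'}.
  by move=> r r' rC r'C; apply/compatP; apply: cl.
split=> // r h; have <- := mx (r |: C); rewrite ?setU11 ?subsetUr //.
move=> s s'; rewrite !inE; case: eqVneq => [->|_] /= sC;
  case: eqVneq => [->|_] //= sC'; apply/compatP.
- exact: compat_refl.
- exact: h.
- by apply: compat_sym; apply: h.
- exact: cl'.
Qed.

(** Total functions standing for P and Q in [thru i r P Q]. Targets increase along a path, so the
    filter cuts it at [i]; the result is a prefix at [i] only if [pass i r] holds. *)
Definition pre i r := [seq e <- edges r | tgt e <= i].
Definition suf i r := [seq e <- edges r | ~~ (tgt e <= i)].
Definition pass i r := dpath 1 (pre i r) i.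

Lemma thru_pre i r P Q : thru i r P Q -> P = pre i r /\ Q = suf i r.
Proof.
case=> h hP hQ; rewrite /pre /suf h !filter_cat.
have aP : all (fun e => tgt e <= i) P.
  by apply/allP => e /(dpath_mem hP)[].
have aQ : all (fun e => ~~ (tgt e <= i)) Q.
  by apply/allP => e /(dpath_mem hQ)[]; have := src_lt_tgt e; lia.
rewrite (all_filterP aP) (all_filterP aQ).
rewrite (@eq_in_filter _ _ pred0) ?filter_pred0 ?cats0; last first.
  by move=> e /(allP aQ)/negPf.
by rewrite (@eq_in_filter _ _ pred0) ?filter_pred0 // => e /(allP aP) ->.
Qed.

Lemma passP i r : pass i r -> thru i r (pre i r) (suf i r).
Proof.
move=> h; apply: thru_cat => //; move: (edges_path r); rewrite /pre /suf.
elim: (edges r) {h} 1 => //= e s IH u /andP[_ h].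
have [_|ei] /= := leqP (tgt e) i; first by congr cons; apply: IH h.
have aQ : all (fun e => ~~ (tgt e <= i)) s.
  by apply/allP => f /(dpath_mem h)[]; have := src_lt_tgt f; lia.
rewrite (all_filterP aQ) (@eq_in_filter _ _ pred0) ?filter_pred0 //.
by move=> f /(allP aQ)/negPf.
Qed.

Lemma thru_pass i r P Q : thru i r P Q -> pass i r.
Proof. by move=> t; rewrite /pass; have [<- _] := thru_pre t; case: t. Qed.

Definition visited C i := [exists r in C, pass i r].
Definition covered C e := [exists r in C, e \in edges r].
Definition used C P := [exists r in C, prefix P (edges r)].

Lemma ex_pre C i (lt : rel (seq edge)) :
  irreflexive lt -> transitive lt -> visited C i ->
  exists r P Q, [/\ r \in C, thru i r P Q &
    forall r' P' Q', r' \in C -> thru i r' P' Q' -> ~~ lt P P'].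
Proof.
move=> irr tr /existsP[r0 /andP[r0C r0i]].
have [|r] := ex_max (pre i) (A := [set r in C | pass i r]) irr tr.
  by apply/set0Pn; exists r0; rewrite inE r0C.
rewrite inE => /andP[rC ri] rmax; exists r, (pre i r), (suf i r).
split=> //; first exact: passP.
move=> r' P' Q' r'C t; have [-> _] := thru_pre t.
by apply: rmax; rewrite inE r'C; apply: thru_pass t.
Qed.

Lemma ex_suf C i (lt : rel (seq edge)) :
  irreflexive lt -> transitive lt -> visited C i ->
  exists r P Q, [/\ r \in C, thru i r P Q &
    forall r' P' Q', r' \in C -> thru i r' P' Q' -> ~~ lt Q Q'].
Proof.
move=> irr tr /existsP[r0 /andP[r0C r0i]].
have [|r] := ex_max (suf i) (A := [set r in C | pass i r]) irr tr.
  by apply/set0Pn; exists r0; rewrite inE r0C.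
rewrite inE => /andP[rC ri] rmax; exists r, (pre i r), (suf i r).
split=> //; first exact: passP.
move=> r' P' Q' r'C t; have [_ ->] := thru_pre t.
by apply: rmax; rewrite inE r'C; apply: thru_pass t.
Qed.

(** * Every edge is covered by a maximal clique *)

Lemma conv_trans (T : Type) (lt : rel T) :
  transitive lt -> transitive (fun x y => lt y x).
Proof. by move=> tr y x z h h'; apply: tr h' h. Qed.

(** Every route of C through [j] leaves along the other edge, so the suffix order against [e :: Q']
    is the same for all of them. If [e] is slack its suffix comes first and the least prefix of C at
    [j] avoids conflicts; otherwise the greatest one does. *)
Lemma anchor_left C j e : inner n j -> visited C j -> src e = j -> ~~ covered C e ->
  exists r P Q, [/\ r \in C, thru j r P Q & forall S R Q', S \in C ->
    thru j R P (e :: Q') -> compat_at j R S].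
Proof.
move=> ij vj ej /existsPn ue.
have key S S0 S1 : S \in C -> thru j S S0 S1 -> exists2 f, isx f = ~~ isx e &
    src f = j /\ exists S2, S1 = f :: S2.
  move=> SC [eS _]; case: S1 eS => [|f S2] eS /=.
    by move/eqP; move: ij; rewrite /inner; lia.
  case/andP=> /eqP fj _; exists f; last by split=> //; exists S2.
  have := ue S; rewrite SC eS mem_cat inE /=; case: (eqVneq e f); rewrite ?orbT //.
  move=> ne _; have : ~ (isx f = isx e).
    by move=> h; case/eqP: ne; symmetry; apply: edge_src_inj; rewrite ?fj ?ej.
  by case: isx; case: isx.
case ex: (isx e).
  have [r [P [Q [rC t m]]]] := ex_pre (lt := fun x y => plt y x) plt_irr (conv_trans plt_trans) vj.
  exists r, P, Q; split=> // S R Q' SC tR P1 Q1 S0 S1 tR' tS.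
  have [<- <-] := thru_uniq tR tR'.
  have [f fx [fj [S2 eS1]]] := key _ _ _ SC tS; subst S1.
  have lt : slt (e :: Q') (f :: S2).
    rewrite /slt /= /out_lt ej fj ij ex fx ex eqxx.
    by case: eqP => // ef; move: fx; rewrite -ef ex.
  by rewrite /conf (negPf (slt_asym lt)) andbF /= (negPf (m _ _ _ SC tS)).
have [r [P [Q [rC t m]]]] := ex_pre plt_irr plt_trans vj.
exists r, P, Q; split=> // S R Q' SC tR P1 Q1 S0 S1 tR' tS.
have [<- <-] := thru_uniq tR tR'.
have [f fx [fj [S2 eS1]]] := key _ _ _ SC tS; subst S1.
have lt : slt (f :: S2) (e :: Q').
  rewrite /slt /= /out_lt ej fj ij ex fx ex eqxx.
  by case: eqP => // ef; move: fx; rewrite ef ex.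
by rewrite /conf (negPf (slt_asym lt)) andbF orbF (negPf (m _ _ _ SC tS)).
Qed.

(** Dual to [anchor_left]: a prefix ending in a slack [e] lies above all prefixes of C at [k] and is
    joined to the greatest suffix, one ending in a nonslack [e] to the least. *)
Lemma anchor_right C k e : inner n k -> visited C k -> tgt e = k -> ~~ covered C e ->
  exists r P Q, [/\ r \in C, thru k r P Q & forall S R P', S \in C ->
    thru k R (rcons P' e) Q -> compat_at k R S].
Proof.
move=> ij vj ej /existsPn ue.
have key S S0 S1 : S \in C -> thru k S S0 S1 -> exists2 f, isx f = ~~ isx e &
    tgt f = k /\ exists S2, S0 = rcons S2 f.
  move=> SC [eS]; elim/last_ind: S0 eS => [|S2 f _] eS /=.
    by move/eqP => k1; move: ij; rewrite /inner -k1.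
  rewrite dpath_rcons; case/andP=> _ /eqP fj _; exists f; last by split=> //; exists S2.
  have := ue S; rewrite SC eS mem_cat mem_rcons inE /=.
  case: (eqVneq e f); rewrite ?orbT //.
  move=> ne _; have : ~ (isx f = isx e).
    by move=> h; case/eqP: ne; symmetry; apply: edge_tgt_inj; rewrite ?fj ?ej.
  by case: isx; case: isx.
case ex: (isx e).
  have [r [P [Q [rC t m]]]] := ex_suf slt_irr slt_trans vj.
  exists r, P, Q; split=> // S R Q' SC tR P1 Q1 S0 S1 tR' tS.
  have [<- <-] := thru_uniq tR tR'.
  have [f fx [fj [S2 eS1]]] := key _ _ _ SC tS; subst S0.
  have lt : plt (rcons S2 f) (rcons Q' e).
    rewrite /plt !rev_rcons /= /in_lt ej fj ij ex fx ex eqxx.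
    by case: eqP => // ef; move: fx; rewrite ef ex.
  by rewrite /conf (negPf (plt_asym lt)) (negPf (m _ _ _ SC tS)) andbF.
have [r [P [Q [rC t m]]]] := ex_suf (lt := fun x y => slt y x) slt_irr (conv_trans slt_trans) vj.
exists r, P, Q; split=> // S R Q' SC tR P1 Q1 S0 S1 tR' tS.
have [<- <-] := thru_uniq tR tR'.
have [f fx [fj [S2 eS1]]] := key _ _ _ SC tS; subst S0.
have lt : plt (rcons Q' e) (rcons S2 f).
  rewrite /plt !rev_rcons /= /in_lt ej fj ij ex fx ex eqxx.
  by case: eqP => // ef; move: fx; rewrite -ef ex.
by rewrite /conf (negPf (plt_asym lt)) orbF (negPf (m _ _ _ SC tS)) andbF.
Qed.

(* An uncovered edge extends to a path of uncovered edges through unvisited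
   vertices; completed by extreme prefixes and suffixes of C, it yields a route
   compatible with C. *)
Definition gap C j W k := [/\ W != [::], dpath j W k &
  forall e, e \in W -> ~~ covered C e /\ (src e != j -> ~~ visited C (src e))].

Lemma coveredP C e : reflect
  (exists r P Q, [/\ r \in C, thru (src e) r P (e :: Q) & thru (tgt e) r (rcons P e) Q])
  (covered C e).
Proof.
apply: (iffP existsP) => [[r /andP[rC er]]|[r [P [Q [rC [h _ _] _]]]]]; last first.
  by exists r; rewrite rC h mem_cat mem_head orbT.
have := edges_path r; have eE := erefl (edges r); case/splitPr: {2}_ / er eE => P Q h.
rewrite h => /dpath_catP[w hP] /= /andP[/eqP ew _].
exists r, P, Q; split=> //; first by apply: thru_cat; rewrite // ew.
by apply: thru_cat; rewrite ?cat_rcons // dpath_rcons ew hP eqxx.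
Qed.

Lemma visited_src C e : covered C e -> visited C (src e).
Proof.
by case/coveredP=> r [P [Q [rC /thru_pass h _]]]; apply/existsP; exists r; rewrite rC.
Qed.

Lemma visited_tgt C e : covered C e -> visited C (tgt e).
Proof.
by case/coveredP=> r [P [Q [rC _ /thru_pass h]]]; apply/existsP; exists r; rewrite rC.
Qed.

(** No edge at an unvisited vertex is covered, so any incoming edge, here the slack one, prolongs
    the gap until it reaches 1 or a visited vertex. *)
Lemma gap_extend_left C j W k : 0 < j -> gap C j W k -> exists j' W',
  [/\ gap C j' W' k & j' = 1 \/ inner n j' /\ visited C j'].
Proof.
have [m] := ubnP j; elim: m j W => // m IH j W jm j0 g.
have [j1|j1] := eqVneq j 1; first by exists j, W; split=> //; left.
have ij : inner n j.
  case: g => W0 + _; rewrite /inner.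
  by case: W W0 => //= e W _ /andP[/eqP ej _]; have := tgt_le e; have := src_lt_tgt e; lia.
have [vj|vj] := boolP (visited C j); first by exists j, W; split=> //; right.
have [e ej _] := edge_tgt_ex true ij; case: g => W0 hW h.
apply: (IH (src e) (e :: W)).
- by have := src_lt_tgt e; lia.
- exact: src_gt0.
split=> //=; first by rewrite eqxx ej.
move=> f; rewrite inE => /orP[/eqP->|fW].
  by rewrite eqxx; split=> //; apply: contra vj; rewrite -ej; apply: visited_tgt.
have [h1 h2] := h f fW; split=> // _.
by have [->//|/h2] := eqVneq (src f) j.
Qed.

Lemma gap_extend_right C j W k : k <= n -> gap C j W k -> exists W' k',
  [/\ gap C j W' k' & k' = n \/ inner n k' /\ visited C k'].
Proof.
have [m] := ubnP (n - k); elim: m k W => // m IH k W km kn g.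
have [nk|nk] := eqVneq k n; first by exists W, k; split=> //; left.
have ik : inner n k.
  rewrite /inner [k < n]ltn_neqAle nk kn !andbT.
  case: g => W0 + _; case/lastP: W W0 => // W e _; rewrite dpath_rcons.
  by case/andP=> _ /eqP <-; apply: tgt_gt1.
have [vk|vk] := boolP (visited C k); first by exists W, k; split=> //; right.
have [e ek _] := edge_src_ex true ik; case: g => W0 hW h.
apply: (IH (tgt e) (rcons W e)).
- by have := src_lt_tgt e; have := tgt_le e; lia.
- exact: tgt_le.
split=> //=; first by case: (W).
  by rewrite dpath_rcons ek hW eqxx.
move=> f; rewrite mem_rcons inE => /orP[/eqP->|/h//].
by rewrite ek; split=> //; apply: contra vk; rewrite -ek; apply: visited_src.
Qed.

Lemma maxcl_no_gap C j W k : maxcl C -> gap C j W k ->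
  j = 1 \/ inner n j /\ visited C j -> k = n \/ inner n k /\ visited C k -> False.
Proof.
move=> [cl mx] [W0 hW hg] hj hk.
have [P [hP hP']] : exists P, dpath 1 P j /\
    (j = 1 \/ inner n j /\ exists r Z, [/\ r \in C, thru j r P Z &
      forall S R Q, S \in C -> thru j R P (W ++ Q) -> compat_at j R S]).
  case: hj => [->|[ij vj]]; first by exists [::]; split=> //; left.
  case: (W) W0 hW hg => // e W' _ /= /andP[/eqP ej _] hg.
  have [|r [P [Z [rC t h]]]] := anchor_left ij vj ej; first by case: (hg e (mem_head e W')).
  exists P; split; first by case: t.
  by right; split=> //; exists r, Z; split=> // S R Q; apply: h.
have [Q [hQ hQ']] : exists Q, dpath k Q n /\
    (k = n \/ inner n k /\ exists r Z, [/\ r \in C, thru k r Z Q &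
      forall S R P, S \in C -> thru k R (P ++ W) Q -> compat_at k R S]).
  case: hk => [->|[ik vk]]; first by exists [::]; rewrite /= eqxx; split=> //; left.
  case/lastP: (W) W0 hW hg => // W' e _; rewrite dpath_rcons => /andP[_ /eqP ek] hg.
  have [|r [Z [Q [rC t h]]]] := anchor_right ik vk ek.
    by case: (hg e _) => //; rewrite mem_rcons mem_head.
  exists Q; split; first by case: t.
  right; split=> //; exists r, Z; split=> // S R P'.
  by rewrite -rcons_cat; apply: h.
have [|R tR] := thru_ex hP (Q := W ++ Q); first by rewrite (dpath_cat _ _ hW).
have eR : edges R = P ++ W ++ Q by case: tR.
have RC : R \in C.
  apply: mx => S SC; apply: (compat_splice eR hP hW).
  - case: hP' => [->|[ij [r [Z [rC t _]]]]]; [by left|right].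
    by split=> //; exists r, Z; split=> // i ii _; apply: compatW => //; apply: cl.
  - case: hQ' => [->|[ik [r [Z [rC t _]]]]]; [by left|right].
    by split=> //; exists r, Z; split=> // i ii _; apply: compatW => //; apply: cl.
  move=> i ii /andP[ji ik].
  have [eij|nij] := eqVneq i j.
    subst i; case: hP' => [j1|[_ [r [Z [_ _ h]]]]]; last by apply: h tR.
    by move: ii; rewrite j1 /inner.
  have [eik|nik] := eqVneq i k.
    subst i; case: hQ' => [kn|[_ [r [Z [_ _ h]]]]].
      by move: ii; rewrite kn /inner ltnn andbF.
    by apply: h (thru_catr tR hW).
  (* Strictly between [j] and [k], a vertex of [R] is the source of an edge of [W] other than the
     first. It is therefore unvisited, contrary to [S] passing through it. *)
  move=> P0 Q0 S0 S1 [eR' hP0 _] /thru_pass tS.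
  exfalso.
  have [|W1 eP0 hW1] := dpath_split _ hP hP0 ji (Q := W ++ Q) (Q' := Q0).
    by rewrite -eR.
  have [|W2 eW hW2] := dpath_split _ hW1 hW ik (Q := Q0) (Q' := Q).
    by move/eqP: eR'; rewrite eR eP0 -catA eqseq_cat // eqxx => /eqP.
  case: W2 eW hW2 => [|f W2] eW /=; first by move/eqP=> ik'; rewrite ik' eqxx in nik.
  case/andP=> /eqP fi _; case: (hg f); first by rewrite eW mem_cat mem_head orbT.
  rewrite fi => _ /(_ nij) /negP[].
  by apply/existsP; exists S; rewrite SC.
case: (W) W0 hW hg eR => // e W' _ _ hg eR.
case: (hg e (mem_head _ _)) => /negP he _; apply: he; apply/existsP; exists R.
by rewrite RC eR mem_cat mem_head orbT.
Qed.

Lemma maxcl_covered C e : maxcl C -> covered C e.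
Proof.
move=> mC; apply: contraT => ne; exfalso.
have g : gap C (src e) [:: e] (tgt e).
  split=> //=; first by rewrite !eqxx.
  by move=> f; rewrite inE => /eqP->; rewrite eqxx.
have [j [W [g' hj]]] := gap_extend_left (src_gt0 e) g.
have [W' [k [g'' hk]]] := gap_extend_right (tgt_le e) g'.
exact: maxcl_no_gap mC g'' hj hk.
Qed.


(** Only [j] needs checking. If S lies above [P0] with a suffix below [Q], its prefix is [P],
    against the minimality of [Q], or is above [P], and then S conflicts with [r]. If S lies below
    [P0] with a suffix above [Q], it is also below [P] and again conflicts with [r]. *)
Lemma consecutive_splice C j r s P0 P Q Z R : maxcl C -> inner n j ->
  r \in C -> thru j r P Q -> s \in C -> thru j s P0 Z -> plt P0 P ->
  (forall S S1, S \in C -> thru j S P S1 -> ~~ slt S1 Q) ->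
  (forall S S0 S1, S \in C -> thru j S S0 S1 -> ~~ (plt P0 S0 && plt S0 P)) ->
  thru j R P0 Q -> R \in C.
Proof.
move=> [cl mx] ij rC tr sC ts lt qmin ncons tR; apply: mx => S SC.
have eR : edges R = P0 ++ [::] ++ Q by case: tR.
have hP0 : dpath 1 P0 j by case: tR.
apply: (compat_splice eR hP0 (eqxx j : dpath j [::] j)).
- right; split=> //; exists s, Z; split=> // i ii _; apply: compatW => //; exact: cl.
- right; split=> //; exists r, P; split=> // i ii _; apply: compatW => //; exact: cl.
move=> i ii; rewrite -eqn_leq => /eqP ij'; subst i => P1 Q1 S0 S1 tR' tS.
have [<- <-] := thru_uniq tR tR'.
have hS0 : dpath 1 S0 j by case: tS.
have hP : dpath 1 P j by case: tr.
have := cl r S rC SC j _ _ _ _ ij tr tS.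
rewrite /conf !negb_or => /andP[c1 c2]; apply/andP; split; apply/negP => /andP[h1 h2].
  have [eS|ne] := eqVneq P S0.
    by move: (qmin S S1 SC); rewrite eS => /(_ tS); rewrite h2.
  case/orP: (plt_total ij hP hS0 ne) => h; first by rewrite h h2 in c1.
  by have := ncons S _ _ SC tS; rewrite h1 h.
by move: c2; rewrite (plt_trans h1 lt) h2.
Qed.

(** * Prefixes at a vertex and their continuations *)

Lemma usedP C P i : dpath 1 P i -> reflect (exists r Q, r \in C /\ thru i r P Q) (used C P).
Proof.
move=> hP; apply: (iffP existsP) => [[r /andP[rC /prefixP[Q h]]]|[r [Q [rC [h _ _]]]]].
  by exists r, Q; split=> //; apply: thru_cat.
by exists r; rewrite rC h prefix_prefix.
Qed.

Lemma used_rconsP C P e : dpath 1 P (src e) ->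
  reflect (exists r Q, r \in C /\ thru (src e) r P (e :: Q)) (used C (rcons P e)).
Proof.
move=> hP; apply: (iffP existsP) => [[r /andP[rC /prefixP[Q h]]]|[r [Q [rC [h _ _]]]]].
  by exists r, Q; split=> //; apply: thru_cat; rewrite // -cat_rcons.
by exists r; rewrite rC h -cat_rcons prefix_prefix.
Qed.

Lemma thru_cons j r P Q : inner n j -> thru j r P Q -> exists e Q', Q = e :: Q' /\ src e = j.
Proof.
move=> ij [_ _]; case: Q => [|e Q] /=; first by move/eqP; move: ij; rewrite /inner; lia.
by case/andP=> /eqP h _; exists e, Q.
Qed.

Lemma slt_cons e e' Q Q' : inner n (src e) -> src e' = src e -> isx e -> ~~ isx e' ->
  slt (e :: Q) (e' :: Q').
Proof.
move=> ie ee ex ex'; rewrite /slt /= /out_lt ie ee ex ex' eqxx /=.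
by case: eqP => // h; move: ex'; rewrite -h ex.
Qed.

Section Overlap.
Variables (C : {set route}) (mC : maxcl C) (j : nat) (ij : inner n j) (ex ey : edge).
Hypotheses (exj : src ex = j) (eyj : src ey = j) (exx : isx ex) (eyy : ~~ isx ey).

(** Suffixes starting with [ex] precede those starting with [ey], so prefixes continuing along [ex]
    lie weakly below those continuing along [ey]; in particular at most one prefix does both. *)
Lemma used_order P P' : dpath 1 P j -> dpath 1 P' j ->
  used C (rcons P ey) -> used C (rcons P' ex) -> ~~ plt P P'.
Proof.
move=> hP hP'; rewrite -eyj in hP; rewrite -exj in hP'.
move=> /(used_rconsP C hP)[r [Q [rC t]]] /(used_rconsP C hP')[r' [Q' [r'C t']]].
rewrite eyj in t; rewrite exj in t'.
have [cl _] := mC; have := cl r r' rC r'C j _ _ _ _ ij t t'.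
by rewrite /conf slt_cons ?andbT ?negb_or ?exj ?eyj // => /andP[].
Qed.

Lemma overlap_uniq P P' : dpath 1 P j -> dpath 1 P' j ->
  used C (rcons P ex) -> used C (rcons P ey) ->
  used C (rcons P' ex) -> used C (rcons P' ey) -> P = P'.
Proof.
move=> hP hP' Px Py P'x P'y; apply/eqP/negPn/negP => /(plt_total ij hP hP').
by rewrite (negPf (used_order hP hP' Py P'x)) (negPf (used_order hP' hP P'y Px)).
Qed.

Lemma thru_edge r P Q : thru j r P Q -> exists Q', Q = ex :: Q' \/ Q = ey :: Q'.
Proof.
move=> t; have [e [Q' [-> ej]]] := thru_cons ij t; exists Q'.
case h: (isx e); [left|right]; congr cons; apply: edge_src_inj.
all: by rewrite ?exj ?eyj ?h ?exx ?(negPf eyy).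
Qed.

Lemma used_split P : dpath 1 P j -> used C P -> used C (rcons P ex) || used C (rcons P ey).
Proof.
move=> hP /(usedP C hP)[r [Q [rC t]]]; have [Q' [] eQ] := thru_edge t; subst Q; apply/orP.
  by left; apply/used_rconsP; rewrite exj //; exists r, Q'.
by right; apply/used_rconsP; rewrite eyj //; exists r, Q'.
Qed.

(** Let [P0] be the greatest prefix continuing along [ex] and [P1] the least continuing along [ey];
    both exist since every edge is covered. If they differ, they are consecutive. The least suffix
    after [P1] starts with [ey], as [P1] lies above [P0], and splicing it to [P0] makes [P0]
    continue along [ey] as well. *)
Lemma overlap_ex :
  exists P, [/\ dpath 1 P j, used C (rcons P ex) & used C (rcons P ey)].
Proof.
pose A e := [set r in C | e \in edges r].
have vis e : src e = j -> visited (A e) j.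
  move=> ej; have /coveredP[r [P [Q [rC t _]]]] := maxcl_covered e mC.
  apply/existsP; exists r; rewrite inE rC; case: (t) => -> _ _.
  by rewrite mem_cat mem_head orbT -ej (thru_pass t).
have Ax e r P Q : src e = j -> r \in A e -> thru j r P Q -> exists Q', Q = e :: Q'.
  move=> ej; rewrite inE => /andP[_] er [h hP hQ].
  move: er; rewrite h mem_cat => /orP[/(dpath_mem hP)[]|].
    by have := src_lt_tgt e; rewrite ej; lia.
  case: Q hQ h => //= f Q /andP[/eqP fj hQ] _; rewrite inE.
  case/orP=> [/eqP->|/(dpath_mem hQ)[]]; first by exists Q.
  by have := src_lt_tgt f; rewrite ej fj; lia.
have used_A e r P Q : src e = j -> r \in A e -> thru j r P Q -> used C (rcons P e).
  move=> ej rA t; have [Q' eQ] := Ax _ _ _ _ ej rA t; subst Q.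
  move: rA t; rewrite inE -ej => /andP[rC _] t.
  by apply/used_rconsP; [case: t|exists r, Q'].
have [r0 [P0 [Q0 [r0A t0 max0]]]] := ex_pre plt_irr plt_trans (vis ex exj).
have [r1 [P1 [Q1 [r1A t1 min1]]]] :=
  ex_pre (lt := fun x y => plt y x) plt_irr (conv_trans plt_trans) (vis ey eyj).
have h0 : dpath 1 P0 j by case: t0.
have h1 : dpath 1 P1 j by case: t1.
have u0 := used_A _ _ _ _ exj r0A t0; have u1 := used_A _ _ _ _ eyj r1A t1.
have [e01|ne] := eqVneq P0 P1; first by exists P0; split=> //; rewrite e01.
have lt : plt P0 P1.
  by have := plt_total ij h0 h1 ne; rewrite (negPf (used_order h1 h0 u1 u0)) orbF. 
(* [ex_suf] is applied to the routes with prefix [P1] only, which gives the least suffix following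
   that prefix. *)
have vB : visited [set r in C | pre j r == P1] j.
  apply/existsP; exists r1; move: r1A; rewrite !inE => /andP[-> _] /=.
  by have [<- _] := thru_pre t1; rewrite eqxx (thru_pass t1).
have [r [P [Q [rB t qmin]]]] := ex_suf (lt := fun x y => slt y x) slt_irr (conv_trans slt_trans) vB.
move: rB; rewrite inE => /andP[rC /eqP rP1].
have eP : P = P1 by case: (thru_pre t) => ->.
subst P; have [Q' eQ] : exists Q', Q = ey :: Q'.
  have [Q' [] eQ] := thru_edge t; last by exists Q'.
  have : r \in A ex by rewrite inE rC; case: t => -> _ _; rewrite mem_cat eQ mem_head orbT.
  by move/max0 => /(_ _ _ t); rewrite lt.
have [R tR] : exists R, thru j R P0 Q by case: t => _ _; apply: thru_ex.
have RC : R \in C.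
  apply: (consecutive_splice mC ij rC t _ t0 lt _ _ tR).
  - by move: r0A; rewrite inE => /andP[].
  - move=> S S1 SC tS; apply: (qmin S P1 S1) => //.
    by rewrite inE SC; case: (thru_pre tS) => <-; rewrite eqxx.
  move=> S S0 S1 SC tS; have [S2 [] eS] := thru_edge tS; rewrite negb_and.
    have : S \in A ex by rewrite inE SC; case: tS => -> _ _; rewrite mem_cat eS mem_head orbT.
    by move/max0 => /(_ _ _ tS) ->.
  have : S \in A ey by rewrite inE SC; case: tS => -> _ _; rewrite mem_cat eS mem_head orbT.
  by move/min1 => /(_ _ _ tS) ->; rewrite orbT.
exists P0; split=> //; apply/used_rconsP; first by rewrite eyj.
by exists R, Q'; rewrite eyj -eQ.
Qed.

End Overlap.

Lemma used_catl C P Q : used C (P ++ Q) -> used C P.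
Proof.
by case/existsP=> r /andP[rC h]; apply/existsP; exists r; rewrite rC (catl_prefix h).
Qed.

Lemma used_src1 C e : maxcl C -> src e = 1 -> used C [:: e].
Proof.
move=> mC e1; have /coveredP[r [P [Q [rC [h + _] _]]]] := maxcl_covered e mC.
rewrite e1 => /dpath_nil P0; apply/existsP; exists r.
by rewrite rC h P0 (prefix_prefix [:: e] Q).
Qed.

Lemma src_inner e : src e != 1 -> inner n (src e).
Proof. by move=> e1; rewrite /inner; have := src_gt0 e; have := src_lt_tgt e; have := tgt_le e; lia. Qed.

Lemma tgt_inner e : tgt e != n -> inner n (tgt e).
Proof. by move=> e1; rewrite /inner; have := tgt_gt1 e; have := tgt_le e; lia. Qed.

(** * The flow of a maximal clique *)

Definition nodes C i := [set P : n.-bseq edge | dpath 1 P i & used C P].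
Definition exts C e := [set P : n.-bseq edge | dpath 1 P (src e) & used C (rcons P e)].

Lemma bseq_ex i P : dpath 1 P i -> i <= n -> exists P' : n.-bseq edge, val P' = P.
Proof.
move=> hP lin; have sP : size P <= n by move/dpath_size: hP; lia.
by exists (Bseq sP).
Qed.

Lemma card_exts_src1 C e : maxcl C -> src e = 1 -> #|exts C e| = 1.
Proof.
move=> mC e1; apply/eqP/cards1P; exists (nil_bseq n edge); apply/setP => P.
rewrite !inE e1; apply/andP/eqP => [[/dpath_nil h _]|->]; first exact: val_inj.
by rewrite /= used_src1.
Qed.

(** The value 0 prescribed on edges leaving vertex 1 fits the general formula: exactly one prefix,
    the empty one, continues along such an edge. *)
Lemma flow_of_cliqueE C e : maxcl C -> flow_of_clique C e = (#|exts C e|%:Z - 1)%R.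
Proof.
by move=> mC; rewrite ffunE; case: eqP => [/(card_exts_src1 mC)->|_].
Qed.

Lemma exts_gt0 C e : maxcl C -> 0 < #|exts C e|.
Proof.
move=> mC; have /coveredP[r [P [Q [rC t _]]]] := maxcl_covered e mC.
have hP : dpath 1 P (src e) by case: t.
have [|P' eP] := bseq_ex hP; first by have := src_lt_tgt e; have := tgt_le e; lia.
apply/card_gt0P; exists P'; rewrite inE eP hP; apply/used_rconsP => //.
by exists r, Q.
Qed.

(** Inclusion and exclusion: the prefix continuing along both edges is counted twice. This surplus
    is the source of the netflow 1 at [j]. *)
Lemma card_exts_src C j ex ey : maxcl C -> inner n j -> src ex = j -> src ey = j ->
  isx ex -> ~~ isx ey -> #|exts C ex| + #|exts C ey| = #|nodes C j|.+1.
Proof.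
move=> mC ij exj eyj exx eyy; rewrite -cardsUI -addn1; congr (_ + _).
  apply: eq_card => P; rewrite !inE exj eyj -andb_orr; apply: andb_id2l => hP.
  apply/orP/idP => [[]|/(used_split ij exj eyj exx eyy hP)/orP//].
    by rewrite -cats1; apply: used_catl.
  by rewrite -cats1; apply: used_catl.
have [P [hP Px Py]] := overlap_ex mC ij exj eyj exx eyy.
have [|P' eP] := bseq_ex hP; first by move: ij; rewrite /inner; lia.
apply/eqP/cards1P; exists P'; apply/setP => P2; rewrite !inE exj eyj.
apply/idP/eqP => [/andP[/andP[h hx] /andP[_ hy]]|->]; last by rewrite eP hP Px Py.
by apply: val_inj; rewrite eP; apply: (overlap_uniq mC ij exj eyj exx eyy).
Qed.

Lemma card_exts_tgt C j ex ey : inner n j -> tgt ex = j -> tgt ey = j ->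
  isx ex -> ~~ isx ey -> #|exts C ex| + #|exts C ey| = #|nodes C j|.
Proof.
move=> ij exj eyj exx eyy; pose f e (P : n.-bseq edge) := insub_bseq n (rcons P e).
(* [insub_bseq] is faithful only up to length n, a bound that a path from 1 respects even with [e]
   appended. *)
have fE e (P : n.-bseq edge) : P \in exts C e -> val (f e P) = rcons P e.
  rewrite inE => /andP[/dpath_size h _]; apply: insubdK.
  by rewrite /= -topredE /= size_rcons; have := src_lt_tgt e; have := tgt_le e; lia.
have fI e : {in exts C e &, injective (f e)}.
  move=> P P' hP hP' h; apply: val_inj.
  have : rcons P e == rcons P' e by rewrite -!fE // h.
  by rewrite eqseq_rcons => /andP[/eqP].
rewrite -(card_in_imset (@fI ex)) -(card_in_imset (@fI ey)) -cardsUI.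
rewrite [X in _ + X]eq_card0 ?addn0; last first.
  move=> P; rewrite inE; apply/negP => /andP[/imsetP[P1 h1 e1] /imsetP[P2 h2 e2]].
  have : rcons P1 ex == rcons P2 ey by rewrite -!fE // -e1 -e2.
  by rewrite eqseq_rcons => /andP[_ /eqP e12]; rewrite e12 (negPf eyy) in exx.
apply: eq_card => P; rewrite !inE; apply/idP/idP.
  by case/orP=> /imsetP[P1 h1 e1]; have h := fE _ _ h1; rewrite -e1 in h;
    move: h1; rewrite inE h dpath_rcons ?exj ?eyj eqxx andbT.
case/andP=> hP uP.
have : exists (P0 : n.-bseq edge) e, P = rcons P0 e :> seq edge.
  move: hP (size_bseq P); case/lastP: (P : seq edge) => [|P0 e].
    by move=> /eqP j1; move: ij; rewrite -j1.
  by rewrite size_rcons => _ sz; exists (Bseq (ltnW sz)), e.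
case=> P0 [e eP]; move: hP uP; rewrite eP dpath_rcons => /andP[hP /eqP ej] uP.
have h0 : P0 \in exts C e by rewrite inE hP.
have Pf : P \in f e @: exts C e by apply/imsetP; exists P0 => //; apply: val_inj; rewrite fE.
case h: (isx e).
  by rewrite -(@edge_tgt_inj ex e) ?Pf ?exj ?h.
by rewrite -(@edge_tgt_inj ey e) ?Pf ?orbT ?eyj ?h ?(negPf eyy).
Qed.

Local Open Scope ring_scope.
Import GRing.Theory Num.Theory.

Lemma sum_by_edge2 (f : edge -> int) (p : pred edge) e1 e2 :
  e1 != e2 -> p e1 -> p e2 -> (forall e, p e -> e = e1 \/ e = e2) ->
  \sum_(e | p e) f e = f e1 + f e2.
Proof.
move=> ne p1 p2 h; rewrite (bigD1 e1) //= (bigD1 e2) //=; last by rewrite p2 eq_sym.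
rewrite big_pred0 ?addr0 // => e; apply/negP => /andP[/andP[/h[]->]].
  by rewrite eqxx.
by rewrite eqxx.
Qed.

Lemma sum_src (f : edge -> int) i ex ey : inner n i -> src ex = i -> src ey = i ->
  isx ex -> ~~ isx ey -> \sum_(e | src e == i) f e = f ex + f ey.
Proof.
move=> ii exi eyi exx eyy; apply: sum_by_edge2; rewrite ?exi ?eyi //.
  by apply: contraNneq eyy => <-.
move=> e /eqP ei; case h: (isx e); [left|right].
  by apply: edge_src_inj; rewrite ?exi ?h.
by apply: edge_src_inj; rewrite ?eyi ?h ?(negPf eyy).
Qed.

Lemma sum_tgt (f : edge -> int) i ex ey : inner n i -> tgt ex = i -> tgt ey = i ->
  isx ex -> ~~ isx ey -> \sum_(e | tgt e == i) f e = f ex + f ey.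
Proof.
move=> ii exi eyi exx eyy; apply: sum_by_edge2; rewrite ?exi ?eyi //.
  by apply: contraNneq eyy => <-.
move=> e /eqP ei; case h: (isx e); [left|right].
  by apply: edge_tgt_inj; rewrite ?exi ?h.
by apply: edge_tgt_inj; rewrite ?eyi ?h ?(negPf eyy).
Qed.

Lemma sum_fibers (f : edge -> int) (g : edge -> nat) : (forall e, 0 < g e <= n)%N ->
  \sum_(1 <= i < n.+1) \sum_(e | g e == i) f e = \sum_e f e.
Proof.
move=> h; rewrite (exchange_big_dep predT) //=; apply: eq_bigr => e _.
under eq_bigl => i do rewrite eq_sym.
by rewrite big_nat1_eq h.
Qed.

(* Conservation at the sink follows from conservation everywhere else. *)
Lemma integer_flow_inner (f : {ffun edge -> int}) :
  (forall e, 0 <= f e) -> (forall e, src e = 1%N -> f e = 0) ->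
  (forall i, inner n i -> \sum_(e | tgt e == i) f e + 1 = \sum_(e | src e == i) f e) ->
  integer_flow f.
Proof.
move=> f0 f1 fi; have c1 : \sum_(e | tgt e == 1%N) f e + netflow n 1 = \sum_(e | src e == 1%N) f e.
  rewrite big_pred0 => [|e]; last by have := tgt_gt1 e; case: eqP => // ->.
  by rewrite big1 // => e /eqP /f1.
have cin i : inner n i -> \sum_(e | tgt e == i) f e + netflow n i = \sum_(e | src e == i) f e.
  move=> ii; rewrite -fi // /netflow; move: ii; rewrite /inner => /andP[i1 i2].
  by do 2?case: eqP => ?; try lia.
split=> // i /andP[i1 lin]; have [->//|ni1] := eqVneq i 1%N.
have [ein|nin] := eqVneq i n; last by apply: cin; rewrite /inner; lia.
subst i; have h1 := sum_fibers f (g := @tgt n) _; have h2 := sum_fibers f (g := @src n) _.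
have {}h1 : \sum_(1 <= i < n.+1) \sum_(e | tgt e == i) f e = \sum_e f e.
  by apply: h1 => e; rewrite tgt_le (ltnW (tgt_gt1 e)).
have {}h2 : \sum_(1 <= i < n.+1) \sum_(e | src e == i) f e = \sum_e f e.
  by apply: h2 => e; have := src_gt0 e; have := src_lt_tgt e; have := tgt_le e; lia.
have hs : \sum_(1 <= i < n) netflow n i = n%:Z - 2.
  rewrite big_ltn ?(ltn_trans _ hn) //= add0r big_nat (eq_bigr (fun _ => 1)); last first.
    by move=> i /andP[j1 j2]; rewrite /netflow; do 2?case: eqP => ?; try lia.
  rewrite -big_nat big_const_nat iter_addr_0 /=.
  by rewrite natz; lia.
move: h1; rewrite -h2 !big_nat_recr ?(ltn_trans _ hn) //=.
have -> : \sum_(1 <= i < n) \sum_(e | src e == i) f e =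
    \sum_(1 <= i < n) \sum_(e | tgt e == i) f e + (n%:Z - 2).
  rewrite -hs -big_split /=; apply: eq_big_nat => i /andP[j1 j2].
  by have [->//|] := eqVneq i 1%N; move=> ?; symmetry; apply: cin; rewrite /inner; lia.
rewrite /netflow eqxx; case: eqP => [|_ h]; first lia.
by rewrite -addrA in h; move/addrI: h => ->; rewrite addrAC subrr add0r.
Qed.

Lemma flow_of_clique_integer C : maxcl C -> integer_flow (flow_of_clique C).
Proof.
move=> mC; apply: integer_flow_inner => [e|e e1|i ii].
- by rewrite flow_of_cliqueE //; have := exts_gt0 e mC; lia.
- by rewrite flow_of_cliqueE // card_exts_src1.
have [ex exi exx] := edge_src_ex true ii; have [ey eyi /negbT eyy] := edge_src_ex false ii.
have [fx fxi fxx] := edge_tgt_ex true ii; have [fy fyi /negbT fyy] := edge_tgt_ex false ii.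
rewrite (sum_src _ ii exi eyi exx eyy) (sum_tgt _ ii fxi fyi fxx fyy) !flow_of_cliqueE //.
have := card_exts_src mC ii exi eyi exx eyy.
by have := card_exts_tgt C ii fxi fyi fxx fyy; lia.
Qed.

Local Close Scope ring_scope.

(** * The flow determines the maximal clique *)

Lemma used_cross C C' j e e' P P' : maxcl C -> maxcl C' -> inner n j ->
  src e = j -> src e' = j -> isx e != isx e' -> dpath 1 P j -> dpath 1 P' j ->
  used C (rcons P e) -> used C (rcons P' e') ->
  used C' (rcons P' e) -> used C' (rcons P e') -> P = P'.
Proof.
move=> mC mC' ij ej e'j ee' hP hP' h1 h2 h3 h4.
apply/eqP; apply: contraT => /(plt_total ij hP hP').
case ex: (isx e); move: ee'; rewrite ex => e'x.
  have e'y : ~~ isx e' by case: isx e'x.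
  by rewrite (negPf (used_order mC ij ej e'j ex e'y hP' hP h2 h1))
             (negPf (used_order mC' ij ej e'j ex e'y hP hP' h4 h3)).
have e'y : isx e' by case: isx e'x.
by rewrite (negPf (used_order mC ij e'j ej e'y (negbT ex) hP hP' h1 h2))
           (negPf (used_order mC' ij e'j ej e'y (negbT ex) hP' hP h3 h4)).
Qed.

(** Suppose P continues along [e] in C but not in C'; in C' it then continues along the other edge.
    If some P' did the opposite, [used_order] in C and in C' would give opposite inequalities
    between P and P', hence P = P'. So [exts C' e] would be a proper subset of [exts C e], against
    the equal cardinalities. *)
Lemma exts_subset C C' e : maxcl C -> maxcl C' -> inner n (src e) ->
  (forall P, dpath 1 P (src e) -> used C P = used C' P) ->
  #|exts C e| = #|exts C' e| -> exts C e \subset exts C' e.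
Proof.
move=> mC mC' ij TT cc; have [e' e'j e'x] := edge_src_ex (~~ isx e) ij.
have ee' : isx e != isx e' by rewrite e'x; case: isx.
have split C0 P : dpath 1 P (src e) -> used C0 P ->
    ~~ used C0 (rcons P e) -> used C0 (rcons P e').
  move=> hP uP n1; case ex: (isx e) e'x => /= e'x.
    by have := used_split ij erefl e'j ex (negbT e'x) hP uP; rewrite (negPf n1).
  by have := used_split ij e'j erefl e'x (negbT ex) hP uP; rewrite (negPf n1) orbF.
apply/fintype.subsetP => P; rewrite !inE => /andP[hP Pe]; rewrite hP /=.
apply: contraT => nP.
have Pe' : used C' (rcons P e').
  by apply: split => //; rewrite -TT //; apply: (@used_catl _ _ [:: e]); rewrite cats1.
suff : #|exts C' e| < #|exts C e| by rewrite cc ltnn.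
apply: proper_card; apply/properP; split; last first.
  by exists P; rewrite inE hP //= (negPf nP).
apply/fintype.subsetP => P'; rewrite !inE => /andP[hP' P'e]; rewrite hP' /=.
apply: contraT => nP'.
have P'e' : used C (rcons P' e').
  by apply: split => //; rewrite TT //; apply: (@used_catl _ _ [:: e]); rewrite cats1.
have := used_cross mC mC' ij erefl e'j ee' hP hP' Pe P'e' P'e Pe'.
by move=> ePP; move: nP; rewrite ePP P'e.
Qed.

(** Induction on the end vertex shows that both cliques use the same prefixes, and the routes are
    the prefixes at n. *)
Lemma flow_of_clique_inj C C' : maxcl C -> maxcl C' ->
  flow_of_clique C = flow_of_clique C' -> C = C'.
Proof.
move=> mC mC' ff.
have cc e : #|exts C e| = #|exts C' e|.
  by have := congr1 (fun f : {ffun edge -> int} => f e) ff; rewrite !flow_of_cliqueE //; lia.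
have un C0 : maxcl C0 -> used C0 [::].
  move=> m0; have i2 : inner n 2 by [].
  have [e _ _] := edge_src_ex true i2.
  have /existsP[r /andP[rC _]] := maxcl_covered e m0.
  by apply/existsP; exists r; rewrite rC prefix0s.
have key j P : dpath 1 P j -> used C P = used C' P.
  have [m] := ubnP j; elim: m j P => // m IH j P jm.
  case/lastP: P => [|P e]; first by rewrite !un.
  rewrite dpath_rcons => /andP[hP /eqP ej].
  have [e1|/src_inner ij] := eqVneq (src e) 1.
    by move: hP; rewrite e1 => /dpath_nil ->; rewrite !used_src1.
  have TT P0 : dpath 1 P0 (src e) -> used C P0 = used C' P0.
    by apply: IH; have := src_lt_tgt e; lia.
  have [|P' eP] := bseq_ex hP; first by have := src_lt_tgt e; have := tgt_le e; lia.
  have s1 := exts_subset mC mC' ij TT (cc e).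
  have s2 : exts C' e \subset exts C e by apply: exts_subset => // P0 h0; rewrite TT.
  have /setP/(_ P') : exts C e = exts C' e by apply/eqP; rewrite eqEsubset s1.
  by rewrite !inE eP hP.
have sub C1 C2 : (forall P, dpath 1 P n -> used C1 P = used C2 P) -> {subset C1 <= C2}.
  move=> h r rC; have : used C2 (edges r).
    by rewrite -h ?edges_path //; apply/existsP; exists r; rewrite rC prefix_refl.
  case/existsP=> r' /andP[r'C /prefixP[Q eQ]].
  have := edges_path r'; rewrite eQ (dpath_cat _ _ (edges_path r)) => /dpath_nil Q0.
  by rewrite Q0 cats0 in eQ; rewrite -(edges_inj eQ).
by apply/setP => r; apply/idP/idP; apply: sub => P /key.
Qed.

(** * Adjacent maximal cliques *)

Lemma thru_back i r X g Y : thru i r (rcons X g) Y -> thru (src g) r X (g :: Y) /\ tgt g = i.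
Proof.
by case=> h; rewrite dpath_rcons => /andP[hX /eqP gi] hY; split=> //;
  apply: thru_cat; rewrite // h cat_rcons.
Qed.

Lemma thru_forth i r X g Y : thru i r X (g :: Y) -> thru (tgt g) r (rcons X g) Y /\ src g = i.
Proof.
by case=> h hX /= /andP[/eqP gi hY]; split=> //; apply: thru_cat;
  rewrite ?cat_rcons // dpath_rcons gi hX eqxx.
Qed.

Lemma thru_rcons i r X Y : inner n i -> thru i r X Y ->
  exists X0 g, X = rcons X0 g /\ tgt g = i.
Proof.
move=> ii [_]; case/lastP: X => [|X g]; first by move=> /eqP i1; move: ii; rewrite -i1.
by rewrite dpath_rcons => /andP[_ /eqP gi] _; exists X, g.
Qed.

Lemma slt_head a b s t : inner n (src a) -> src b = src a -> isx b != isx a ->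
  slt (a :: s) (b :: t) = isx a.
Proof.
move=> ia ab kk; rewrite /slt /= /out_lt ia ab eqxx /=.
by case: (_ =P _ :> edge) kk => [->|_]; [rewrite eqxx|case: isx; case: isx].
Qed.

Lemma plt_last a b s t : inner n (tgt a) -> tgt b = tgt a -> isx b != isx a ->
  plt (rcons s a) (rcons t b) = isx b.
Proof.
move=> ia ab kk; rewrite /plt !rev_rcons /= /in_lt ia ab eqxx /=.
by case: (_ =P _ :> edge) kk => [->|_]; [rewrite eqxx|case: isx; case: isx].
Qed.

Lemma plt_rcons a s t : plt (rcons s a) (rcons t a) = plt s t.
Proof. by rewrite -!cats1 plt_cat. Qed.

(* r is the only route of C whose prefix P at v continues along e, while P also
   continues along the other edge e'; so the prefix Pe is extreme at its end. *)
Section LoneExtension.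
Variables (C : {set route}) (r R : route) (v : nat) (P : seq edge) (e e' : edge).
Variables (Q1 Z : seq edge).
Hypotheses (mC : maxcl C) (iv : inner n v).
Hypotheses (rC : r \in C) (tr : thru v r P (e :: Q1)).
Hypotheses (RC : R \in C) (tR : thru v R P (e' :: Z)) (ee' : isx e' != isx e).
Hypothesis lone : forall S Y, S \in C -> thru v S P (e :: Y) -> S = r.

(** The prefix Pe is greatest if [e] is slack and least otherwise. Against a prefix ending in the
    other kind of edge the framing decides; one ending in [e] is compared with P at [v] through [R],
    which leaves P along [e']. *)
Lemma lone_extreme S X Y : inner n (tgt e) -> S \in C -> thru (tgt e) S X Y ->
  ~~ (if isx e then plt (rcons P e) X else plt X (rcons P e)).
Proof.
move=> ie SC tS; have [X0 [g [eX ge]]] := thru_rcons ie tS; subst X.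
have [_ ev] := thru_forth tr; have [_ e'v] := thru_forth tR.
have [kk|kk] := eqVneq (isx g) (isx e); last first.
  rewrite plt_last ?ge // plt_last ?ge //; last by rewrite eq_sym.
  by case: (isx e) kk; case: isx.
have eg : g = e by apply: edge_tgt_inj.
subst g; have [tS' _] := thru_back tS; rewrite ev in tS'.
have [cl _] := mC; have := cl _ _ SC RC v _ _ _ _ iv tS' tR.
have e'e : isx e != isx e' by rewrite eq_sym.
rewrite /conf !plt_rcons !slt_head ?ev ?e'v //.
by move: e'e; case: (isx e); case: (isx e') => //= _; rewrite ?andbT ?andbF ?orbF.
Qed.

(** Were [f] of the kind of [e], take a route S of C through the other edge [g] leaving [tgt e]. Its
    prefix differs from Pe, which only [r] continues, so it lies on the side left by [lone_extreme],
    while [f] and [g] are ordered the opposite way: S and [r] conflict. *)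
Lemma lone_next f T : inner n (tgt e) -> Q1 = f :: T -> isx f != isx e.
Proof.
move=> ie eQ; apply/eqP => fe.
have [tr1 ev] := thru_forth tr; rewrite eQ in tr1; have [_ fs] := thru_forth tr1.
have [g gs gx] := edge_src_ex (~~ isx e) ie.
have /coveredP[S [X [Y [SC tS _]]]] := maxcl_covered g mC; rewrite gs in tS.
have hX := lone_extreme ie SC tS.
have ne : rcons P e != X.
  apply/eqP => eX; subst X; have [tS' _] := thru_back tS; rewrite ev in tS'.
  have eS := lone SC tS'; subst S; have [_ [gf _]] := thru_uniq tr1 tS.
  by move: gx; rewrite -gf fe; case: isx.
have [cl _] := mC; have := cl _ _ rC SC _ _ _ _ _ ie tr1 tS.
have d1 : dpath 1 X (tgt e) by case: tS.
have d0 : dpath 1 (rcons P e) (tgt e) by case: tr1.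
have := plt_total ie d0 d1 ne; move: hX.
rewrite /conf !slt_head ?fs ?gs ?gx ?fe //; try by case: isx.
by case: (isx e) => /=; rewrite ?andbT ?andbF ?orbF => /negPf-> //=; rewrite ?orbF => ->.
Qed.

End LoneExtension.

(** If P precedes P' and Q' precedes Q, the pair (P, Q') is the low corner: a pair above it in the
    prefix and below in the suffix conflicts with (P, Q), one below in the prefix and above in the
    suffix with (P', Q'). *)
Lemma conf_cross P Q P' Q' S0 S1 : conf P Q P' Q' -> conf P Q' S0 S1 ->
  conf P Q S0 S1 || conf P' Q' S0 S1.
Proof.
rewrite /conf => /orP[]/andP[h1 h2] /orP[]/andP[h3 h4].
- by rewrite h3 (slt_trans h4 h2).
- by rewrite (plt_trans h3 h1) h4 !orbT.
- by rewrite (plt_trans h1 h3) h4 !orbT.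
- by rewrite h3 (slt_trans h2 h4) !orbT.
Qed.

Lemma cross_in C r r' v P Q P' Q' R : maxcl C -> r \in C ->
  (forall S, S \in C -> S != r -> compat r' S) -> inner n v ->
  thru v r P Q -> thru v r' P' Q' -> conf P Q P' Q' ->
  (forall i, inner n i -> v < i -> compat_at i r' r) ->
  thru v R P Q' -> R \in C :\ r.
Proof.
move=> [cl mx] rC cr' iv tr tr' cf last tR; rewrite !inE; apply/andP; split.
  apply: contraTneq cf => eR; subst R; have [_ <-] := thru_uniq tr tR.
  by rewrite /conf slt_irr !andbF.
apply: mx => S SC; have eR : edges R = P ++ [::] ++ Q' by case: tR.
have hP : dpath 1 P v by case: tR.
apply: (compat_splice eR hP (eqxx v : dpath v [::] v)).
- right; split=> //; exists r, Q; split=> // i ii _; apply: compatW => //; exact: cl.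
- right; split=> //; exists r', P'; split=> // i ii vi.
  by have [->|ne] := eqVneq S r; [apply: last|apply: compatW => //; apply: cr'].
move=> i ii; rewrite -eqn_leq => /eqP iv'; subst i => P1 Q1 S0 S1 tR' tS.
have [<- <-] := thru_uniq tR tR'.
have [eS|ne] := eqVneq S r.
  by subst S; have [<- _] := thru_uniq tr tS; rewrite /conf plt_irr.
apply/negP => /(conf_cross cf)/orP[] c.
  by have := cl _ _ rC SC v _ _ _ _ iv tr tS; rewrite c.
by have := cr' _ SC ne v _ _ _ _ iv tr' tS; rewrite c.
Qed.

Lemma prefix_catE (s P Q : seq edge) : prefix s (P ++ Q) ->
  prefix s P \/ exists Q0, Q0 != [::] /\ s = P ++ Q0 /\ prefix Q0 Q.
Proof.
elim: P s => [|a P IH] [|b s] //=; try by left.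
  by move=> h; right; exists (b :: s).
by case: eqP => // -> /IH[h|[Q0 [n0 [-> h]]]]; [left|right; exists Q0].
Qed.

(** Adjoining [r] adds nothing along P, which [R] already follows. No route of K follows Pe, so each
    edge of the tail gains exactly one prefix. *)
Lemma card_exts_setU1 (K : {set route}) r R v P e Q1 Z f : thru v r P (e :: Q1) ->
  R \in K -> edges R = P ++ Z -> ~~ used K (rcons P e) ->
  #|exts (r |: K) f| = #|exts K f| + (f \in e :: Q1).
Proof.
move=> tr RK eR nK; have [eE hP hQ] := tr.
have usedU X : used (r |: K) X = prefix X (edges r) || used K X.
  apply/existsP/orP => [[S]|[h|/existsP[S /andP[SK h]]]].
  - rewrite !inE => /andP[/orP[/eqP->|SK] h]; first by left.
    by right; apply/existsP; exists S; rewrite SK.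
  - by exists r; rewrite setU11.
  - by exists S; rewrite !inE SK orbT.
have nK' Q0 Q2 : Q0 != [::] -> prefix Q0 (e :: Q1) -> ~~ used K (P ++ Q0 ++ Q2).
  case: Q0 => // g Q0 _ /=; case: eqP => // -> _; apply: contra nK.
  by rewrite /= -cat_rcons; apply: used_catl.
have [fQ|fQ] := boolP (f \in e :: Q1); last first.
  rewrite addn0; apply: eq_card => X; rewrite !inE usedU; apply: andb_id2l => hX.
  apply/orP/idP => [[]|->]; [|by []|by right].
  rewrite eE => /prefix_catE[/prefixP[P2 eP]|[Q0 [Q0n [eX Q0p]]]].
    apply/existsP; exists R; rewrite RK eR eP -catA; exact: prefix_prefix.
  case/lastP: Q0 Q0n eX Q0p => // Q0 g _; rewrite -rcons_cat => /eqP.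
  rewrite eqseq_rcons => /andP[_ /eqP <-] /prefixP[Q2 eQ].
  by move: fQ; rewrite eQ mem_cat mem_rcons mem_head.
have [Q0 [Q2 eQ]] : exists Q0 Q2, e :: Q1 = Q0 ++ f :: Q2.
  by case/splitPr: fQ => Q0 Q2; exists Q0, Q2.
rewrite eQ in hQ; have [w hw] := dpath_catP hQ; move=> /= /andP[/eqP fw _]; have hX : dpath 1 (P ++ Q0) (src f) by rewrite (dpath_cat _ _ hP) fw.
have [|X0 eX0] := bseq_ex hX; first by have := src_lt_tgt f; have := tgt_le f; lia.
have nX0 : X0 \notin exts K f.
  rewrite inE eX0 negb_and -cats1 -catA; apply/orP; right.
  have := @nK' (Q0 ++ [:: f]) [::]; rewrite cats0; apply; first by case: (Q0).
  by rewrite eQ cats1 -cat_rcons prefix_prefix.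
suff -> : exts (r |: K) f = X0 |: exts K f by rewrite cardsU1 nX0 addnC.
apply/setP => X.
rewrite !inE usedU; apply/idP/idP.
  case/andP=> hXf /orP[|->]; last by rewrite hXf orbT.
  rewrite eE => h; apply/orP.
  case/prefix_catE: (h) => [/prefixP[P2 eP]|[Q3 _]].
    right; rewrite hXf; apply/existsP; exists R; rewrite RK eR eP -catA.
    exact: prefix_prefix.
  left; apply/eqP; apply: val_inj; rewrite eX0.
  case/prefixP: h => s; rewrite eQ cat_rcons => h.
  rewrite catA in h; symmetry; exact: (dpath_cut h hX hXf).
case/orP=> [/eqP->|/andP[-> ->]]; last by rewrite orbT.
by rewrite eX0 hX eE eQ -cat_rcons rcons_cat catA prefix_prefix.
Qed.

Lemma is_xE i e : is_x i e = isx e && (src e == i).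
Proof. by case: e. Qed.

Lemma is_yE i e : 1 < i -> is_y i e = ~~ isx e && (src e == i).
Proof. by case: e => //= k i1; case: ifP => // /eqP ->; lia. Qed.

Lemma eq_isx e f : inner n (src e) -> isx e -> (f == e) = is_x (src e) f.
Proof.
move=> ie ex; rewrite is_xE; apply/eqP/andP => [->|[fx /eqP fe]]; first by rewrite ex.
by apply: edge_src_inj; rewrite ?fx.
Qed.

Lemma eq_isy e f : inner n (src e) -> ~~ isx e -> (f == e) = is_y (src e) f.
Proof.
move=> ie ey; rewrite is_yE; last by case/andP: ie.
apply/eqP/andP => [->|[fx /eqP fe]]; first by rewrite ey.
by apply: edge_src_inj; rewrite ?(negPf fx) ?(negPf ey).
Qed.

Lemma tgt_x e : isx e -> tgt e = (src e).+1.
Proof. by rewrite tgtE => ->. Qed.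

Lemma tgt_y e : inner n (src e) -> ~~ isx e -> tgt e = minn n (src e).+2.
Proof.
by rewrite tgtE /inner => h /negPf ->; case: e h => //= k; case: eqP.
Qed.

Lemma dpath_to_n P i : dpath n P i -> P = [::].
Proof. by case: P => //= e P /andP[/eqP en _]; have := src_lt_tgt e; have := tgt_le e; lia. Qed.

(** The nonexistent edges near the sink drop out of the general formulas, so the truncated moves
    need no separate statement. *)
Lemma is_xy_far i e : n <= i -> (is_x i e = false) * (is_y i e = false).
Proof.
move=> ni; have i1 : 1 < i by lia.
by split; [rewrite is_xE|rewrite is_yE //]; apply/negP => /andP[_ /eqP ei];
  have := src_lt_tgt e; have := tgt_le e; lia.
Qed.

(** For one edge, [a] counts prefixes in the common part, while [i], [d] and [t] say whether the
    edge is increased by the move, decreased by it, or lies in the common tail T. *)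
Lemma shift_count (a : nat) (i d t : bool) : ~~ (t && (i || d)) ->
  ((a + (i || t))%:Z - 1 = (a + (d || t))%:Z - 1 - d%:Z + i%:Z)%R.
Proof. by case: t; case: i; case: d => //= _; lia. Qed.

(** * Exchange of one route: the shape of the two suffixes *)

Section Exchange.
Variables (C C' : {set route}) (r r' : route) (v : nat) (P Q P' Q' : seq edge).
Hypotheses (mC : maxcl C) (mC' : maxcl C') (rC : r \in C) (r'C' : r' \in C').
Hypotheses (eqK : C :\ r = C' :\ r') (iv : inner n v).
Hypotheses (tr : thru v r P Q) (tr' : thru v r' P' Q').
Hypotheses (ltP : plt P P') (ltQ : slt Q' Q).
Hypothesis last_conflict : forall i, inner n i -> v < i -> compat_at i r r'.

(** A common first edge of Q and Q' would carry the conflict to its target, beyond the last one. A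
    second route of C starting with Pe would also belong to C' and conflict there with [r']; the
    same holds with the roles exchanged. *)
Lemma exchange_tail : exists e Q1 e' Q1' R1 R2, [/\
  [/\ Q = e :: Q1, Q' = e' :: Q1', ~~ isx e & isx e'],
  [/\ R1 \in C :\ r, thru v R1 P Q', R2 \in C' :\ r' & thru v R2 P' Q],
  (forall S Y, S \in C -> thru v S P (e :: Y) -> S = r) &
  (forall S Y, S \in C' -> thru v S P' (e' :: Y) -> S = r')].
Proof.
have [cl _] := mC; have [cl' _] := mC'.
have inK S : S \in C -> S != r -> S \in C'.
  by move=> SC ne; have /setP/(_ S) := eqK; rewrite !inE ne SC => /esym/andP[].
have inK' S : S \in C' -> S != r' -> S \in C.
  by move=> SC ne; have /setP/(_ S) := eqK; rewrite !inE ne SC => /andP[].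
have cf : conf P Q P' Q' by rewrite /conf ltP ltQ.
have [R1 tR1] : exists R1, thru v R1 P Q'.
  by case: (tr) => _ hP _; case: (tr') => _ _; apply: thru_ex.
have [R2 tR2] : exists R2, thru v R2 P' Q.
  by case: (tr) => _ _ hQ; case: (tr') => _ hP' _; apply: thru_ex.
have R1K : R1 \in C :\ r.
  apply: (cross_in mC rC _ iv tr tr' cf _ tR1) => [S SC ne|i ii vi].
    by apply: cl' => //; apply: inK.
  by apply: compat_atC; apply: last_conflict.
have R2K : R2 \in C' :\ r'.
  apply: (cross_in mC' r'C' _ iv tr' tr _ last_conflict tR2); last by rewrite confC.
  by move=> S SC ne; apply: cl => //; apply: inK'.
have [e [Q1 [eQ ev]]] := thru_cons iv tr; have [e' [Q1' [eQ' e'v]]] := thru_cons iv tr'.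
have [ex e'x] : ~~ isx e /\ isx e'.
  move: ltQ; rewrite eQ eQ' /slt /=; case: eqP => [ee lt|_ /and4P[_ _ -> ->]] //.
  exfalso; move: tr tr'; rewrite eQ eQ' ee => /thru_forth[t1 _] /thru_forth[t1' _].
  have [en|/tgt_inner ie] := eqVneq (tgt e) n.
    by case: t1 t1' => _ _; rewrite en => /dpath_to_n Q0 [_ _ /dpath_to_n Q0']; rewrite Q0 Q0' in lt.
  have vlt : v < tgt e by rewrite -ev src_lt_tgt.
  have := last_conflict ie vlt t1 t1'.
  by rewrite /conf plt_rcons ltP /slt lt.
have cross S S' Y Y' : S \in C -> S' \in C' -> S = r \/ S' = r' ->
     thru v S P (e :: Y) -> thru v S' P' (e' :: Y') -> (S \in C') || (S' \in C) -> False.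
  move=> SC SC' _ t t' h.
  have lt : slt (e' :: Y') (e :: Y) by rewrite slt_head ?e'v ?ev // (negPf ex) e'x.
  suff : compat S S' by move/(_ v _ _ _ _ iv t t'); rewrite /conf ltP lt.
  by case/orP: h => h; [apply: cl'|apply: cl].
have tre : thru v r P (e :: Q1) by rewrite -eQ.
have tre' : thru v r' P' (e' :: Q1') by rewrite -eQ'.
exists e, Q1, e', Q1', R1, R2; split=> // S Y SC t; apply/eqP; apply: contraT => ne.
  by case: (cross S r' Y Q1' SC r'C' (or_intror erefl) t tre'); rewrite inK.
by case: (cross r S Q1 Y rC SC (or_introl erefl) tre t); rewrite (inK' S) ?orbT.
Qed.

(* At v+3 the added and the removed route occupy the same place among the
   common prefixes; the largest common prefix below that place then forces the
   same suffix on both. *)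
Lemma exchange_suffix e e' f f' T T' : Q = [:: e, f & T] -> Q' = [:: e', f' & T'] ->
  inner n (tgt e) -> inner n (tgt e') -> inner n (tgt f) -> tgt f' = tgt f ->
  isx f -> ~~ isx f' -> T = T'.
Proof.
move=> eQ eQ' ie ie' iw ff fx f'y.
have [e0 [Q1 [e0' [Q1' [R1 [R2 [[eQ0 eQ0' ex e'x] [R1K tR1 R2K tR2] lone lone']]]]]]] :=
  exchange_tail.
move: eQ0 eQ0' tR1 tR2 (tr) (tr'); rewrite eQ eQ' => -[ee eQ1] [ee' eQ1'] tR1 tR2 tre tre'.
subst e0 e0' Q1 Q1'.
have [R1C _] : R1 \in C /\ R1 != r by move: R1K; rewrite !inE => /andP[].
have [R2C _] : R2 \in C' /\ R2 != r' by move: R2K; rewrite !inE => /andP[].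
have kk : isx e' != isx e by rewrite e'x (negPf ex).
have kk' : isx e != isx e' by rewrite e'x (negPf ex).
have ext S X Y := lone_extreme mC iv tre R1C tR1 kk (S := S) (X := X) (Y := Y) ie.
have ext' S X Y := lone_extreme mC' iv tre' R2C tR2 kk' (S := S) (X := X) (Y := Y) ie'.
rewrite (negPf ex) in ext; rewrite e'x in ext'.
have [tre1 ev] := thru_forth tre; have [tre2 fe] := thru_forth tre1.
have [tre1' e'v] := thru_forth tre'; have [tre2' f'e] := thru_forth tre1'.
rewrite ff in tre2'.
set p := rcons (rcons P e) f in tre2; set p' := rcons (rcons P' e') f' in tre2'.
have [cl _] := mC; have [cl' _] := mC'.
have KC S : S \in C :\ r -> S \in C by rewrite !inE => /andP[].
have KC' S : S \in C :\ r -> S \in C' by rewrite eqK !inE => /andP[].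
have CK S X Y : S \in C -> thru (tgt f) S (rcons X f') Y -> S \in C :\ r.
  move=> SC tS; rewrite !inE SC andbT; apply: contraTneq fx => eS; subst S.
  have [/eqP + _] := thru_uniq tre2 tS; rewrite eqseq_rcons => /andP[_ /eqP ->].
  exact: f'y.
(* [A] holds the common routes entering [tgt f] along [f']. Its greatest prefix lies immediately
   below [p] in C and immediately below [p'] in C'. *)
pose A := [set S in C :\ r | (pass (tgt f) S) && (last f (pre (tgt f) S) == f')].
have AE S X Y : thru (tgt f) S X Y -> (S \in A) = (S \in C :\ r) && (last f X == f').
  by move=> tS; have [-> _] := thru_pre tS; rewrite inE (thru_pass tS).
have vA : visited A (tgt f).
  have /coveredP[S [X [Y [SC _ tS]]]] := maxcl_covered f' mC; rewrite ff in tS.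
  apply/existsP; exists S; rewrite (thru_pass tS) andbT (AE _ _ _ tS) last_rcons eqxx.
  by rewrite (CK _ _ _ SC tS).
have [S0 [s [Z [S0A tS0 smax]]]] := ex_pre plt_irr plt_trans vA.
have S0K : S0 \in C :\ r by move: S0A; rewrite (AE _ _ _ tS0) => /andP[].
have [X0 [g [es gf]]] := thru_rcons iw tS0.
have eg : g = f' by move: S0A; rewrite (AE _ _ _ tS0) es last_rcons => /andP[_ /eqP].
subst g s.
have lt : plt (rcons X0 f') p by rewrite plt_last ?ff ?fx ?(negPf f'y).
have lt' : plt (rcons X0 f') p'.
  rewrite plt_rcons; have [tX0 _] := thru_back tS0; rewrite f'e in tX0.
  have := ext' _ _ _ (KC' _ S0K) tX0.
  have [|] := boolP (X0 == rcons P' e').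
    move/eqP => eX0; subst X0; have [tX1 _] := thru_back tX0; rewrite e'v in tX1.
    have eS := lone' _ _ (KC' _ S0K) tX1.
    by move: S0K; rewrite eqK eS !inE eqxx.
  move=> ne; have d0 : dpath 1 X0 (tgt e') by case: tX0.
  have d1 : dpath 1 (rcons P' e') (tgt e') by case: tre1'.
  by case/orP: (plt_total ie' d0 d1 ne) => // ->.
have smaxK S X Y : S \in C :\ r -> thru (tgt f) S (rcons X f') Y ->
    ~~ plt (rcons X0 f') (rcons X f').
  by move=> SK tS; apply: (smax S _ Y _ tS); rewrite (AE _ _ _ tS) SK last_rcons eqxx.
have cases S X Y : thru (tgt f) S X Y -> exists X1 g, X = rcons X1 g /\ (g = f \/ g = f').
  move=> tS; have [X1 [h [eX hf]]] := thru_rcons iw tS; exists X1, h; split=> //.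
  case hx : (isx h); [left|right]; first by apply: edge_tgt_inj; rewrite ?hx.
  by apply: edge_tgt_inj; rewrite ?ff ?hx ?(negPf f'y).
have dX0 : dpath 1 (rcons X0 f') (tgt f) by case: tS0.
have [R3 tR3] : exists R3, thru (tgt f) R3 (rcons X0 f') T.
  by case: tre2 => _ _; apply: thru_ex.
have [R4 tR4] : exists R4, thru (tgt f) R4 (rcons X0 f') T'.
  by case: tre2' => _ _; apply: thru_ex.
(* Only [r] continues Pe in C, so [T] is the only suffix after [p] and hence the least one; likewise
   for [T'] after [p'] in C'. *)
have R3C : R3 \in C.
  apply: (consecutive_splice mC iw rC tre2 (KC _ S0K) tS0 lt _ _ tR3) => [S S1 SC tS|S X Y SC tS].
    have [tS' _] := thru_back tS; rewrite fe in tS'; have [tS'' _] := thru_back tS'.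
    rewrite ev in tS''; have eS := lone _ _ SC tS''; subst S.
    by have [_ <-] := thru_uniq tre2 tS; rewrite slt_irr.
  have [X1 [g [eX [eg|eg]]]] := cases _ _ _ tS; subst X g; rewrite negb_and.
    have [tS' _] := thru_back tS; rewrite fe in tS'.
    by rewrite plt_rcons (ext _ _ _ SC tS') orbT.
  by rewrite (smaxK _ _ _ (CK _ _ _ SC tS) tS).
have R4C : R4 \in C'.
  apply: (consecutive_splice mC' iw r'C' tre2' (KC' _ S0K) tS0 lt' _ _ tR4) => [S S1 SC tS|S X Y SC tS].
    have [tS' _] := thru_back tS; rewrite f'e in tS'; have [tS'' _] := thru_back tS'.
    rewrite e'v in tS''; have eS := lone' _ _ SC tS''; subst S.
    by have [_ <-] := thru_uniq tre2' tS; rewrite slt_irr.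
  have [X1 [g [eX [eg|eg]]]] := cases _ _ _ tS; subst X g; rewrite negb_and.
    by rewrite [X in _ || ~~ X]plt_last ?ff ?fx ?(negPf f'y) ?orbT.
  have [eS|ne] := eqVneq S r'.
    by subst S; have [<- _] := thru_uniq tre2' tS; rewrite plt_irr orbT.
  by rewrite (smaxK S X1 Y) // eqK !inE ne.
have R4K : R4 \in C.
  apply: KC; rewrite eqK !inE R4C andbT; apply: contraTneq lt' => eR; subst R4.
  by have [<- _] := thru_uniq tre2' tR4; rewrite plt_irr.
have R3K : R3 \in C'.
  apply: KC'; rewrite !inE R3C andbT; apply: contraTneq lt => eR; subst R3.
  by have [<- _] := thru_uniq tre2 tR3; rewrite plt_irr.
apply/eqP; apply: contraT => ne.
have dT : dpath (tgt f) T n by case: tre2.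
have dT' : dpath (tgt f) T' n by case: tre2'.
(* Both splices are common routes. [R4] against [r] excludes that T precedes T', and [R3] against
   [r'] excludes the reverse. *)
have := cl _ _ R4K rC _ _ _ _ _ iw tR4 tre2.
have := cl' _ _ R3K r'C' _ _ _ _ _ iw tR3 tre2'.
rewrite /conf lt lt' /= !negb_or => /andP[h1 _] /andP[h2 _].
by have := slt_total iw dT dT' ne; rewrite (negPf h1) (negPf h2).
Qed.

(** The cases are v = n-1, v = n-2 and smaller v. In the first two T is empty and the edges that
    would follow do not exist. The bound on sources keeps T away from the edges touched by the
    move. *)
Lemma exchange_support : exists T : seq edge, [/\ forall f, f \in T -> v.+3 <= src f,
  forall f, (f \in Q) = [|| is_x v.+2 f, is_y v f | f \in T] &
  forall f, (f \in Q') = [|| is_x v f, is_y v.+1 f | f \in T]].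
Proof.
have [e [Q1 [e' [Q1' [R1 [R2 [[eQ eQ' ex e'x] [R1K tR1 R2K tR2] lone lone']]]]]]] :=
  exchange_tail.
have tre : thru v r P (e :: Q1) by rewrite -eQ.
have tre' : thru v r' P' (e' :: Q1') by rewrite -eQ'.
have [tre1 ev] := thru_forth tre; have [tre1' e'v] := thru_forth tre'.
have iv' := iv; case/andP: iv' => v1 vn.
have te' : tgt e' = v.+1 by rewrite tgt_x // e'v.
have te : tgt e = minn n v.+2 by rewrite tgt_y ?ev.
have xE f : is_x v f = (f == e') by rewrite eq_isx ?e'v.
have yE f : is_y v f = (f == e) by rewrite eq_isy ?ev.
have [e'n|/tgt_inner ie'] := eqVneq (tgt e') n.
  rewrite te' in e'n; have Q10 : Q1 = [::].
    case: tre1 => _ _; have -> : tgt e = n by rewrite te -e'n; apply/minn_idPl.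
    exact: dpath_to_n.
  have Q10' : Q1' = [::] by case: tre1' => _ _; rewrite te' e'n; apply: dpath_to_n.
  have n1 : n <= v.+1 by rewrite e'n.
  exists [::]; split=> // f; rewrite ?eQ ?Q10 ?eQ' ?Q10' inE.
    by rewrite (is_xy_far f (leqW n1)) yE orbF.
  by rewrite (is_xy_far f n1) xE orbF.
have R2C : R2 \in C' by move: R2K; rewrite !inE => /andP[].
have R1C : R1 \in C by move: R1K; rewrite !inE => /andP[].
have tR1' : thru v R1 P (e' :: Q1') by rewrite -eQ'.
have tR2' : thru v R2 P' (e :: Q1) by rewrite -eQ.
have kk : isx e' != isx e by rewrite e'x (negPf ex).
have kk' : isx e != isx e' by rewrite e'x (negPf ex).
have [f' [T' [eQ1' f's]]] := thru_cons ie' tre1'.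
have f'y : ~~ isx f'.
  by have := lone_next mC' iv r'C' tre' R2C tR2' kk' lone' ie' eQ1'; rewrite e'x; case: isx.
rewrite te' in f's; have if' : inner n v.+1 by rewrite -te'.
have tf' : tgt f' = minn n v.+3 by rewrite tgt_y ?f's.
have y'E f : is_y v.+1 f = (f == f') by rewrite eq_isy ?f's.
rewrite eQ1' in tre1'; have [tre2' _] := thru_forth tre1'.
have [en|/tgt_inner ie] := eqVneq (tgt e) n.
  have Q10 : Q1 = [::] by case: tre1 => _ _; rewrite en; apply: dpath_to_n.
  have nv : n <= v.+2 by apply/minn_idPl; rewrite -te.
  have T0 : T' = [::].
    case: tre2' => _ _; have -> : tgt f' = n; last exact: dpath_to_n.
    by rewrite tf'; apply/minn_idPl; apply: leqW.
  exists [::]; split=> // f.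
    by rewrite eQ Q10 inE (is_xy_far f nv) yE orbF.
  by rewrite eQ' eQ1' T0 !inE xE y'E orbF.
have [f [T [eQ1 fs]]] := thru_cons ie tre1.
have fx : isx f.
  by have := lone_next mC iv rC tre R1C tR1' kk lone ie eQ1; rewrite (negPf ex); case: isx.
have te2 : tgt e = v.+2.
  rewrite te; apply/minn_idPr; rewrite leqNgt; apply/negP => /ltnW/minn_idPl nv.
  by move: ie; rewrite te nv /inner ltnn andbF.
rewrite te2 in fs; have i_f : inner n v.+2 by rewrite -te2.
have x'E g : is_x v.+2 g = (g == f) by rewrite eq_isx ?fs.
have tf : tgt f = v.+3 by rewrite tgt_x // fs.
have tff : tgt f' = tgt f by rewrite tf tf'; apply/minn_idPr; case/andP: i_f.
rewrite eQ1 in tre1; have [tre2 _] := thru_forth tre1.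
have eTT : T = T'.
  have [fn|/tgt_inner i3] := eqVneq (tgt f) n.
    case: tre2 tre2' => _ _; rewrite tff fn => /dpath_to_n -> [_ _].
    by move=> /dpath_to_n ->.
  by apply: (exchange_suffix _ _ ie ie' i3 tff fx f'y); rewrite ?eQ ?eQ1 ?eQ' ?eQ1'.
exists T; split=> g.
- by case: tre2 => _ _ /dpath_mem h /h[]; rewrite tf.
- by rewrite eQ eQ1 !inE yE x'E orbCA.
by rewrite eQ' eQ1' -eTT !inE xE y'E.
Qed.

(** Both cliques are compared with their common part, where [r] adds one prefix on each edge of Q
    and [r'] one on each edge of Q'. The routes PQ' and P'Q witness that P and P' remain in use
    there. *)
Lemma exchange_move : exists k : 'I_(n - 2),
  flow_of_clique C = apply_move (true, k) (flow_of_clique C').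
Proof.
have [e [Q1 [e' [Q1' [R1 [R2 [[eQ eQ' ex e'x] [R1K tR1 R2K tR2] lone lone']]]]]]] :=
  exchange_tail.
have [T [Tv QE Q'E]] := exchange_support.
have tre : thru v r P (e :: Q1) by rewrite -eQ.
have tre' : thru v r' P' (e' :: Q1') by rewrite -eQ'.
have iv' := iv; case/andP: iv' => v1 vn.
have kn : v - 2 < n - 2 by apply: ltn_sub2r => //; apply: leq_trans vn.
exists (Ordinal kn); apply/ffunP => f; rewrite [RHS]ffunE !flow_of_cliqueE //.
have hP : dpath 1 P v by case: tre.
have hP' : dpath 1 P' v by case: tre'.
have nK : ~~ used (C :\ r) (rcons P e).
  have [_ ev] := thru_forth tre; rewrite -ev in hP lone *.
  apply/negP => /(used_rconsP _ hP)[S [Y []]]; rewrite !inE => /andP[ne SC] /(lone S Y SC) eS.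
  by rewrite eS eqxx in ne.
have nK' : ~~ used (C' :\ r') (rcons P' e').
  have [_ ev] := thru_forth tre'; rewrite -ev in hP' lone' *.
  apply/negP => /(used_rconsP _ hP')[S [Y []]]; rewrite !inE => /andP[ne SC] /(lone' S Y SC) eS.
  by rewrite eS eqxx in ne.
have eR1 : edges R1 = P ++ Q' by case: tR1.
have eR2 : edges R2 = P' ++ Q by case: tR2.
have := card_exts_setU1 f tre R1K eR1 nK; rewrite setD1K // -eQ => ->.
have := card_exts_setU1 f tre' R2K eR2 nK'; rewrite setD1K // -eQ' eqK => ->.
rewrite QE Q'E /dec_edge /inc_edge /=.
have -> : (v - 2).+2 = v by rewrite -addn2 subnK.
rewrite !orbA; apply: shift_count; apply/negP => /andP[/Tv h].
rewrite !is_xE !is_yE ?(leqW v1) //.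
by rewrite (gtn_eqF h) (gtn_eqF (ltnW h)) (gtn_eqF (ltnW (ltnW h))) !andbF.
Qed.

End Exchange.

(** A decidable form of conflict at a vertex, so that a last one can be selected. *)
Definition conflictb i r r' :=
  [&& inner n i, pass i r, pass i r' & conf (pre i r) (suf i r) (pre i r') (suf i r')].

Lemma compat_atP i r r' : inner n i -> reflect (compat_at i r r') (~~ conflictb i r r').
Proof.
move=> ii; rewrite /conflictb ii; apply: (iffP idP) => [h P Q P' Q' t t'|h].
  have [-> ->] := thru_pre t; have [-> ->] := thru_pre t'.
  by move: h; rewrite (thru_pass t) (thru_pass t').
by apply/negP => /and4P[_ /passP t /passP t']; apply/negP; apply: h.
Qed.

Lemma last_conflict_ex r r' : ~ compat r r' -> exists v P Q P' Q',
  [/\ inner n v, thru v r P Q, thru v r' P' Q', conf P Q P' Q' &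
    forall i, inner n i -> v < i -> compat_at i r r'].
Proof.
move=> ncf; have ex : exists i, conflictb i r r'.
  have [/existsP[i hi]|/existsPn h] := boolP [exists i : 'I_n, conflictb i r r'].
    by exists i.
  case: ncf => i P Q P' Q' ii; apply/compat_atP => //.
  by case/andP: (ii) => _ lt; apply: (h (Ordinal lt)).
have ub i : conflictb i r r' -> i <= n by case/and4P=> /andP[_ /ltnW].
case: (ex_maxnP ex ub) => v /and4P[iv /passP t /passP t' cf] vmax.
exists v, (pre v r), (suf v r), (pre v r'), (suf v r'); split=> // i ii vi.
by apply/compat_atP => //; apply/negP => /vmax; rewrite leqNgt vi.
Qed.

(** If [r] and [r'] were compatible, maximality would put [r] into C' and force C = C'. Which of the
    two flows is the raised one depends on the orientation of the last conflict. *)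
Lemma adjacent_move C C' r r' : maxcl C -> maxcl C' -> C <> C' -> r \in C -> r' \in C' ->
  C :\ r = C' :\ r' -> exists k : 'I_(n - 2),
    flow_of_clique C = apply_move (true, k) (flow_of_clique C') \/
    flow_of_clique C' = apply_move (true, k) (flow_of_clique C).
Proof.
move=> mC mC' neC rC r'C' eqK.
have /last_conflict_ex[v [P [Q [P' [Q' [iv t t' cf lc]]]]]] : ~ compat r r'.
  move=> h; have [cl' mx'] := mC'; have [cl mx] := mC.
  have rC' : r \in C'.
    apply: mx' => S SC'; have [->//|ne] := eqVneq S r'.
    by apply: cl => //; have /setP/(_ S) := eqK; rewrite !inE ne SC' => /andP[].
  case: neC; rewrite -(setD1K rC) eqK.
  have [err|ne] := eqVneq r r'; first by rewrite err setD1K.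
  by have /setP/(_ r) := eqK; rewrite !inE eqxx ne rC'.
case/orP: cf => /andP[h1 h2].
  by have [k hk] := exchange_move mC mC' rC r'C' eqK iv t t' h1 h2 lc; exists k; left.
have lc' i : inner n i -> v < i -> compat_at i r' r.
  by move=> ii vi; apply: compat_atC; apply: lc.
by have [k hk] := exchange_move mC' mC r'C' rC (esym eqK) iv t' t h1 h2 lc'; exists k; right.
Qed.

Local Open Scope ring_scope.
Import Order.TTheory.

Implicit Types f g : {ffun edge -> int}.

(** * Coordinates and elementary moves *)

(** The index [k] stands for the coordinate k+2. The sum starts at y_2, as y_0 and y_1 leave vertex
    1 and carry no flow. *)
Definition coords (f : {ffun edge -> int}) : 'rV[int]_(n - 2) :=
  \row_k \sum_(j : 'I_n | (1 < j <= k.+2)%N) f (inr j).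

Lemma sum_ord_delta K i : (K < n)%N ->
  \sum_(j : 'I_n | (1 < j <= K)%N) (nat_of_bool (val j == i))%:Z = nat_of_bool (1 < i <= K)%N.
Proof.
move=> Kn; case: (boolP (1 < i <= K)%N) => [iK|niK].
  have iN : (i < n)%N by case/andP: iK => _ iK; apply: leq_ltn_trans Kn.
  rewrite (bigD1 (Ordinal iN)) //= eqxx big1 ?addr0 // => j /andP[_ ji].
  by case: eqP => // e; case/eqP: ji; apply: val_inj.
rewrite big1 // => j jK; case: eqP => // ji.
by rewrite -ji jK in niK.
Qed.

Lemma coords_move m f :
  coords (apply_move m f) = coords f + (if m.1 then 1 else -1) *: delta_mx 0 m.2.
Proof.
case: m => b l; apply/rowP => k; rewrite !mxE ?eqxx /=.
have kn : (k.+2 < n)%N by have := ltn_ord k; lia.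
under eq_bigr => j _ do rewrite ffunE.
rewrite !big_split /= sumrN -addrA; congr (_ + _).
(* The gain at y_(l+2) counts when l <= k and the loss at y_(l+3) when l < k, so they cancel unless
   k = l. *)
rewrite /dec_edge /inc_edge /=; case: b => /=; rewrite !sum_ord_delta //.
  by have [->|] := eqVneq k l; [lia|rewrite -val_eqE /=; lia].
by have [->|] := eqVneq k l; [lia|rewrite -val_eqE /=; lia].
Qed.

Lemma coords_moves f ms g : moves_lead f ms g -> coords g = coords f + displacement ms.
Proof.
rewrite /displacement; elim: ms f => [|m ms IH] f /=; first by move=> ->; rewrite big_nil addr0.
by case=> _ /IH ->; rewrite coords_move big_cons addrA.
Qed.

Lemma coords_flow0 : coords (flow0 n) = 0.
Proof. by apply/rowP => k; rewrite !mxE big1 // => j _; rewrite ffunE. Qed.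

Lemma flow_src1 f e : integer_flow f -> src e = 1%N -> f e = 0.
Proof.
case=> f0 fc e1; have n0 : (0 < n)%N by lia.
have := fc 1%N; rewrite n0 => /(_ isT).
rewrite big_pred0 => [|g]; last by have := tgt_gt1 g; case: eqP => // ->.
by rewrite addr0 => /esym/psumr_eq0P -> //; rewrite ?e1.
Qed.

Lemma integer_flow_cons f i : integer_flow f -> inner n i ->
  \sum_(e | tgt e == i) f e + 1 = \sum_(e | src e == i) f e.
Proof.
case=> _ fc /andP[i1 i2]; rewrite -fc; last by rewrite (ltnW i1) (ltnW i2).
by rewrite /netflow (gtn_eqF i1) (ltn_eqF i2).
Qed.

Lemma coords_inj f g : integer_flow f -> integer_flow g -> coords f = coords g -> f = g.
Proof.
move=> hf hg fg.
have hy j : (1 < j)%N -> forall jn : (j < n)%N, f (inr (Ordinal jn)) = g (inr (Ordinal jn)).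
  have [m] := ubnP j; elim: m j => // m IH j jm j1 jn.
  have kn : (j - 2 < n - 2)%N by lia.
  have /rowP/(_ (Ordinal kn)) := fg; rewrite !mxE /=.
  rewrite (bigD1 (Ordinal jn)) /=; last by lia.
  rewrite [in RHS](bigD1 (Ordinal jn)) /=; last by lia.
  rewrite [X in _ + X = _ -> _](eq_bigr (fun i => g (inr i))); first by move/addIr.
  move=> [i iN] /andP[/andP[i1 i2]]; rewrite -val_eqE /= => ij.
  by apply: IH => //=; move: i2 ij => /=; lia.
(* Once the nonslack values agree, the slack ones follow by induction on the source: edges into
   [src e] start earlier, and conservation there leaves one unknown. *)
apply/ffunP => e; have [m] := ubnP (src e); elim: m e => // m IH e em.
have [e1|/src_inner ie] := eqVneq (src e) 1%N; first by rewrite !flow_src1.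
have hy' e' : inner n (src e') -> ~~ isx e' -> f e' = g e'.
  case: e' => // -[j jn] ie' _; apply: hy; move: ie'; rewrite /inner /=.
  by case: ifP => //; lia.
case ex: (isx e); last by apply: hy'; rewrite ?ex.
have [ey eys /negbT eyy] := edge_src_ex false ie.
have := integer_flow_cons hf ie; have := integer_flow_cons hg ie.
rewrite !(sum_src _ ie erefl eys ex eyy) (hy' ey) ?eys //.
rewrite (eq_bigr f) => [-> /addIr->//|e' /eqP e't].
by apply/esym/IH; have := src_lt_tgt e'; lia.
Qed.

(** * Connecting every flow to the initial one *)

Lemma src_x e : isx e -> src e = (tgt e).-1.
Proof. by case: e. Qed.

(** The maximum covers y_0, whose source is 1 instead of 0. *)
Lemma src_y e : inner n (tgt e) -> ~~ isx e -> src e = maxn 1 (tgt e).-2.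
Proof.
move=> ie ey; have := src_gt0 e; have := src_lt_tgt e; move: ie.
rewrite [tgt e]tgtE (negPf ey) /inner; case: ifP => [|_]; last by lia.
by case: (e) => //= k ->; lia.
Qed.

Lemma lower_integer l f : integer_flow f -> (forall e, dec_edge (false, l) e -> 0 < f e) ->
  integer_flow (apply_move (false, l) f).
Proof.
move=> hf fpos; have [f0 _] := hf; apply: integer_flow_inner => [e|e e1|i ii].
- rewrite ffunE; have := f0 e; have := fpos e.
  by case: dec_edge => [/(_ isT)|_]; case: inc_edge; lia.
- rewrite ffunE flow_src1 // /dec_edge /inc_edge /= !is_xE !is_yE // e1.
  by rewrite !andbF.
have [ex exi exx] := edge_src_ex true ii; have [ey eyi /negbT eyy] := edge_src_ex false ii.
have [fx fxi fxx] := edge_tgt_ex true ii; have [fy fyi /negbT fyy] := edge_tgt_ex false ii.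
have := integer_flow_cons hf ii.
rewrite !(sum_src _ ii exi eyi exx eyy) !(sum_tgt _ ii fxi fyi fxx fyy).
rewrite !ffunE /dec_edge /inc_edge /= !is_xE !is_yE // exx fxx (negPf eyy) (negPf fyy) /=.
rewrite exi eyi (src_x fxx) src_y ?fyi // fxi; case/andP: ii => i1 _.
move: (f ex) (f ey) (f fx) (f fy) i1; clear; move: (nat_of_ord l) => v a b c d i1.
rewrite !orbF.
have -> : (i.-1 == v.+2) = (i == v.+3) by lia.
have -> : (i.-1 == v.+4) = (i == v.+4.+1) by lia.
have -> : (maxn 1 i.-2 == v.+2) = (i == v.+4) by lia.
have -> : (maxn 1 i.-2 == v.+3) = (i == v.+4.+1) by lia.
by lia.
Qed.

Lemma flow0_integer : integer_flow (flow0 n).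
Proof.
apply: integer_flow_inner => [[k|k]|[k|k]|i ii]; rewrite ?ffunE //=; first by case=> ->.
have [ex exi exx] := edge_src_ex true ii; have [ey eyi /negbT eyy] := edge_src_ex false ii.
have [fx fxi fxx] := edge_tgt_ex true ii; have [fy fyi /negbT fyy] := edge_tgt_ex false ii.
rewrite (sum_src _ ii exi eyi exx eyy) (sum_tgt _ ii fxi fyi fxx fyy) !ffunE.
case: ex fx ey fy exi exx eyi eyy fxi fxx fyi fyy => // a [] // b [] // c [] //= d.
by move=> *; lia.
Qed.

(** Take the largest j >= 2 with flow on y_j; if there is none, the coordinates vanish and the flow
    is [flow0]. If x_(j+2) exists, it carries flow too: the outflow at j+2 is at least 1 and y_(j+2)
    carries none. *)
Lemma flow_lower f : integer_flow f -> f <> flow0 n -> exists l : 'I_(n - 2),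
  forall e, dec_edge (false, l) e -> 0 < f e.
Proof.
move=> hf ne; have [f0 _] := hf.
pose p (j : nat) := [exists k : 'I_n, [&& nat_of_ord k == j, (1 < j)%N & f (inr k) != 0]].
have ex : exists j, p j.
  have [|/existsPn h] := boolP [exists k : 'I_n, (1 < k)%N && (f (inr k) != 0)].
    by case/existsP=> k hk; exists (nat_of_ord k); apply/existsP; exists k; rewrite eqxx.
  case: ne; apply: coords_inj => //; first exact: flow0_integer.
  rewrite coords_flow0; apply/rowP => k; rewrite !mxE big1 // => j /andP[j1 _].
  by have := h j; rewrite j1 negbK => /eqP.
have ub j : p j -> (j <= n)%N by case/existsP=> k /andP[/eqP <- _]; apply: ltnW.
case: (ex_maxnP ex ub) => j /existsP[k /and3P[/eqP kj j1 fk]] jmax.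
have fpos e : f e != 0 -> 0 < f e by rewrite lt_def f0 andbT.
have jn : (j < n)%N by rewrite -kj.
have ln : (j - 2 < n - 2)%N by lia.
exists (Ordinal ln) => e; rewrite /dec_edge /=.
have -> : (j - 2).+2 = j by lia.
case/orP=> [|ey]; last first.
  have -> : e = inr k by case: e ey => //= k' /eqP k'j; congr inr; apply: val_inj; rewrite /= k'j.
  exact: fpos.
rewrite is_xE => /andP[ex' /eqP ej].
have ie : inner n (src e) by apply: src_inner; rewrite ej.
have [ey eys /negbT eyy] := edge_src_ex false ie.
have := integer_flow_cons hf ie; rewrite (sum_src _ ie erefl eys ex' eyy).
have -> : f ey = 0.
  apply/eqP; apply: contraT => fy; case: ey eys eyy fy => // k' eys _ fy.
  have k'j : val k' = j.+2 by move: eys; rewrite ej /=; case: ifP => // _; lia.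
  have : p j.+2 by apply/existsP; exists k'; rewrite k'j eqxx fy.
  by move/jmax; rewrite ltnNge leqnSn.
have : 0 <= \sum_(e' | tgt e' == src e) f e' by apply: sumr_ge0.
by move: (\sum_(e' | tgt e' == src e) f e') => s; lia.
Qed.

Lemma moves_lead_rcons f ms m h : moves_lead f ms h -> applies m h ->
  moves_lead f (rcons ms m) (apply_move m h).
Proof. by elim: ms f => [|m' ms IH] f /= => [->|[? /IH hm]] // /hm. Qed.

(** Induction on the sum [mu] of the coordinates, which a lowering decreases by 1. The raising move
    that undoes it applies, since it decreases exactly the edges just increased. *)
Lemma moves_connect f : integer_flow f -> exists ms, moves_lead (flow0 n) ms f.
Proof.
pose mu g := \sum_k coords g 0 k.
have mu0 g : integer_flow g -> 0 <= mu g.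
  by case=> f0 _; apply: sumr_ge0 => k _; rewrite mxE; apply: sumr_ge0.
have [m] := ubnP `|mu f|%N; elim: m f => // m IH f fm hf.
have [->|/eqP ne] := eqVneq f (flow0 n); first by exists [::].
have [l hl] := flow_lower hf ne; have hg := lower_integer hf hl.
have mug : mu (apply_move (false, l) f) = mu f - 1.
  rewrite /mu coords_move /=; under eq_bigr => k _ do rewrite mxE.
  rewrite big_split /=; congr (_ + _); rewrite (bigD1 l) //= !mxE !eqxx mulr1 big1 ?addr0 //.
  by move=> k /negPf kl; rewrite !mxE kl andbF mulr0.
have [ms hms] : exists ms, moves_lead (flow0 n) ms (apply_move (false, l) f).
  apply: IH => //; have := mu0 _ hg; have := mu0 _ hf; rewrite mug.
  by move: (mu f) fm => z; lia.
exists (rcons ms (true, l)).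
have -> : f = apply_move (true, l) (apply_move (false, l) f).
  by apply/ffunP => e; rewrite !ffunE /dec_edge /inc_edge /= addrK subrK.
apply: moves_lead_rcons => //; split=> // e he; rewrite ffunE.
have [f0 _] := hf; have := f0 e; have := hl e.
have -> : inc_edge (false, l) e by exact: he.
by case: dec_edge => [/(_ isT)|_]; lia.
Qed.

(** * Convex hulls *)

(** Sources increase along Q, so only its first edge can be the first edge of P. *)
Lemma subset_dpath u v P Q : dpath u P v -> dpath u Q v -> {subset P <= Q} -> P = Q.
Proof.
elim: P Q u => [|e P IH] [|f Q] u //=.
- by move=> /eqP -> h _; have /dpath_nil : dpath v (f :: Q) v by [].
- by move=> _ _ /(_ e (mem_head _ _)).
move=> /andP[/eqP eu hP] /andP[/eqP fu hQ] sPQ.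
have ef : e = f.
  have := sPQ e (mem_head _ _); rewrite inE => /orP[/eqP//|/(dpath_mem hQ)[]].
  by have := src_lt_tgt f; lia.
subst f; congr cons; apply: (IH _ _ hP hQ) => g gP.
have := sPQ g; rewrite !inE gP orbT => /(_ isT)/orP[/eqP ge|//].
by have [] := dpath_mem hP gP; have := src_lt_tgt e; rewrite ge; lia.
Qed.

Section Hull.
Variable R : realType.

Lemma indicator_hull C r : r \in C -> hull R C (indicator R r).
Proof.
move=> rC; exists (fun s => (s == r)%:R); split.
- by move=> s _; apply: ler0n.
- by rewrite (bigD1 r) //= eqxx big1 ?addr0 // => s /andP[_ /negPf ->].
apply/ffunP => e; rewrite [RHS]ffunE (bigD1 r) //= eqxx mul1r big1 ?addr0 //.
by move=> s /andP[_ /negPf ->]; rewrite mul0r.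
Qed.

(** Off the edges of [r] a sum of nonnegative terms vanishes, so a route of nonzero weight uses only
    edges of [r] and hence equals [r]. *)
Lemma indicator_hull_mem C r : hull R C (indicator R r) -> r \in C.
Proof.
case=> w [w0 w1 wE].
have /existsP[s /andP[sC ws]] : [exists s in C, w s != 0].
  apply: contraT => /existsPn h; have := oner_neq0 R; rewrite -w1 big1 ?eqxx // => s sC.
  by have := h s; rewrite sC negbK => /eqP.
suff rs : edges s = edges r by rewrite -(edges_inj rs).
apply: subset_dpath (edges_path s) (edges_path r) _ => e es; apply: contraT => er.
have pos s' : s' \in C -> 0 <= w s' * indicator R s' e.
  by move=> s'C; rewrite ffunE mulr_ge0 ?w0 ?ler0n.
have /ffunP/(_ e) := wE; rewrite [RHS]ffunE [LHS]ffunE (negPf er).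
move=> /esym/(psumr_eq0P pos)/(_ s sC)/eqP.
by rewrite ffunE es mulr1 (negPf ws).
Qed.

Lemma hull_inj : injective (@hull R n).
Proof.
move=> C C' h; apply/setP => r; apply/idP/idP => /indicator_hull; first rewrite h.
  exact: indicator_hull_mem.
by rewrite -h; apply: indicator_hull_mem.
Qed.

Lemma coordinate_vector_hull C u : maximal_clique C ->
  coordinate_vector (hull R C) u <-> u = coords (flow_of_clique C).
Proof.
move=> mC; split=> [[C0 [ms [_ /hull_inj <- /coords_moves -> ->]]]|->].
  by rewrite coords_flow0 add0r.
have [ms hms] := moves_connect (flow_of_clique_integer (maximal_clique_maxcl mC)).
by exists C, ms; split=> //; rewrite (coords_moves hms) coords_flow0 add0r.
Qed.

Lemma grid_embedding :
  exists x : set {ffun edge -> R} -> 'rV[int]_(n - 2),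
    [/\ forall D, triangulation R n D ->
          forall v, coordinate_vector D v <-> v = x D,
        forall D D', triangulation R n D -> triangulation R n D' ->
          x D = x D' -> D = D' &
        forall D D', triangulation R n D -> triangulation R n D' ->
          dual_adjacent D D' -> grid_adjacent (x D) (x D')].
Proof.
(* Off the triangulation no vector qualifies and the value is the default 0. *)
exists (fun D => xget 0 (fun u => coordinate_vector D u)).
have xE C : maximal_clique C ->
    xget 0 (fun u => coordinate_vector (hull R C) u) = coords (flow_of_clique C).
  move=> mC; apply: xget_unique; first exact/coordinate_vector_hull.
  by move=> u /coordinate_vector_hull; apply.
split.
- by move=> _ [C [mC ->]] u; rewrite xE //; apply: coordinate_vector_hull.
- move=> _ _ [C [mC ->]] [C' [mC' ->]]; rewrite !xE // => h.
  have mxC := maximal_clique_maxcl mC; have mxC' := maximal_clique_maxcl mC'.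
  by rewrite (flow_of_clique_inj mxC mxC' (coords_inj _ _ h)) //;
    apply: flow_of_clique_integer.
move=> D D' _ _ [neD [F [[C [r [mC eD rC eF]]] [C' [r' [mC' eD' r'C' eF']]]]]].
subst D D'; rewrite !xE //; rewrite eF in eF'; move/hull_inj: eF' => eK.
have neC : C <> C' by move=> eC; apply: neD; rewrite eC.
have [k [] ->] := adjacent_move (maximal_clique_maxcl mC) (maximal_clique_maxcl mC')
  neC rC r'C' eK; exists k; rewrite coords_move /= scale1r; [right|left] => //.
by rewrite addrK.
Qed.

End Hull.
End Zigzag.

Theorem theorem5 (R : realType) (n : nat) (hn : (3 <= n)%N) :
  exists x : set {ffun edge n -> R} -> 'rV[int]_(n - 2),
    [/\ forall D, triangulation R n D ->
          forall v, coordinate_vector D v <-> v = x D,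
        forall D D', triangulation R n D -> triangulation R n D' ->
          x D = x D' -> D = D' &
        forall D D', triangulation R n D -> triangulation R n D' ->
          dual_adjacent D D' -> grid_adjacent (x D) (x D')].
Proof. exact: grid_embedding. Qed.
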